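(* Let $M$ be an oriented 2-dimensional smooth manifold and let $\sigma\in\Sigma_4(M)$ be a regular symbol. Then $\sigma$ has constant type if and only if there exists a linear connection $\nabla^{\sigma}$ in the tangent bundle of $M$ such that $$\nabla^{\sigma}_X(\sigma)=0$$ for all vector fields $X$ on $M$.
   Context: $\Sigma_4(M)=C^\infty(S^4(TM))$ is the module of symmetric 4-vector fields on $M$ (called symbols). In local coordinates $(x,y)$, $\sigma=a_0\partial_x^4+4a_1\partial_x^3\cdot\partial_y+6a_2\partial_x^2\cdot\partial_y^2+4a_3\partial_x\cdot\partial_y^3+a_4\partial_y^4$, where $\cdot$ is the symmetric product. The symbol is regular if at every point the discriminant of $\sigma$, considered as a homogeneous polynomial of degree 4 in two variables on the cotangent space, is nonzero. Let $V$ be a 2-dimensional real vector space. A $\mathrm{GL}(V)$-orbit $\varpi\subset S^4(V)$ is regular if it is given by equations $I_1=c_1,\dots,I_m=c_m$, where $I_1,\dots,I_m$ are independent $\mathrm{GL}(V)$-invariants in a neighborhood of $\varpi$, the $c_i$ are constants, and $m$ is the codimension of $\varpi$. A symbol $\sigma\in\Sigma_4(M)$ has constant type $\varpi$, where $\varpi$ is such a regular orbit, if for every point $q\in M$ and every linear isomorphism $\varphi:T_qM\to V$ the image $\varphi_*(\sigma_q)\in S^4(V)$ belongs to $\varpi$; $\sigma$ has constant type if it has constant type $\varpi$ for some such orbit $\varpi$.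
   Formalization: M is additionally assumed connected; otherwise the claim fails: on two disjoint discs with constant regular symbols in different GL-orbits, the flat connection preserves σ, but σ is not of constant type. *)

(* Defs.v *)
From HB Require Import structures.
From mathcomp Require Import all_boot all_order all_algebra.
From mathcomp Require Import ring lra.
From mathcomp Require Import all_classical all_reals all_analysis.
Set Implicit Arguments.
Unset Strict Implicit.
Unset Printing Implicit Defensive.
Import Order.TTheory GRing.Theory Num.Theory.
Import numFieldNormedType.Exports.
Local Open Scope classical_set_scope.
Local Open Scope ring_scope.

Section Smooth.
Variables (R : realType) (V W : normedModType R).

(* Meant for open U: [differentiable] and ['D_v f] look at f near each point. *)
Fixpoint Ck (k : nat) (U : set V) (f : V -> W) : Prop :=
  if k is k'.+1 then
    (forall x, U x -> differentiable f x) /\ (forall v, Ck k' U ('D_v f))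
  else forall x, U x -> {for x, continuous f}.

Definition smooth (U : set V) (f : V -> W) : Prop := forall k, Ck k U f.

End Smooth.

Section Quartics.
Variable R : realType.

(* The model of S^4(V), for V = R^2 with basis (e_0, e_1): s = (a_0, ..., a_4)
   is the symmetric 4-vector
     a_0 e_0^4 + 4 a_1 e_0^3.e_1 + 6 a_2 e_0^2.e_1^2 + 4 a_3 e_0.e_1^3 + a_4 e_1^4,
   whose tensor components are s^{ijkl} = a_(i+j+k+l). *)
Definition S4 := 'rV[R]_5.

Definition tens (s : S4) (i j k l : 'I_2) : R := s 0 (inord (i + j + k + l)).

(* The inverse of [tens] on symmetric tensors. *)
Definition untens (T : 'I_2 -> 'I_2 -> 'I_2 -> 'I_2 -> R) : S4 :=
  \row_(m < 5) T (inord (0 < m)) (inord (1 < m)) (inord (2 < m)) (inord (3 < m)).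

(* s as a homogeneous polynomial of degree 4 on the dual space. *)
Definition form (s : S4) (p : 'rV[R]_2) : R :=
  \sum_i \sum_j \sum_k \sum_l tens s i j k l * p 0 i * p 0 j * p 0 k * p 0 l.

(* Image of s under the linear map of matrix A: as usual for row vectors, the
   map is v |-> v *m A, i.e. it sends e_a to the a-th row of A. *)
Definition push (A : 'M[R]_2) (s : S4) : S4 :=
  untens (fun i j k l => \sum_a \sum_b \sum_c \sum_d
    tens s a b c d * A a i * A b j * A c k * A d l).

(* Action of gl(V) on S^4(V): the extension of v |-> v *m B as a derivation. *)
Definition gl_act (B : 'M[R]_2) (s : S4) : S4 :=
  untens (fun i j k l => \sum_a
    (tens s a j k l * B a i + tens s i a k l * B a j
     + tens s i j a l * B a k + tens s i j k a * B a l)).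

(* The discriminant of
     a_0 x^4 + 4 a_1 x^3 y + 6 a_2 x^2 y^2 + 4 a_3 x y^3 + a_4 y^4
   through its invariants of degrees 2 and 3; see [disc_split]. *)
Definition disc (s : S4) : R :=
  let a (k : nat) : R := s 0 (inord k) in
  let i2 := a 0%N * a 4%N - 4 * a 1%N * a 3%N + 3 * a 2%N ^+ 2 in
  let i3 := a 0%N * a 2%N * a 4%N + 2 * a 1%N * a 2%N * a 3%N - a 2%N ^+ 3
            - a 0%N * a 3%N ^+ 2 - a 1%N ^+ 2 * a 4%N in
  256 * (i2 ^+ 3 - 27 * i3 ^+ 2).

Definition GL_orbit (s : S4) : set S4 :=
  [set t | exists2 A : 'M[R]_2, A \in unitmx & t = push A s].

(* The tangent space at s of its orbit is the image of B |-> gl_act B s, whose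
   rank is thus the dimension of the orbit. *)
Definition orbit_dim (s : S4) : nat := \rank (lin_mx (gl_act^~ s)).

Definition regular_orbit (w : set S4) : Prop :=
  (exists s, w = GL_orbit s) /\
  exists (m : nat) (U : set S4) (I : 'I_m -> S4 -> R^o) (c : 'I_m -> R),
    [/\ open U /\ w `<=` U,
        (forall s, w s -> m + orbit_dim s = 5)%N,
        (forall i, smooth U (I i)) /\
        (forall i A s, A \in unitmx -> U s -> U (push A s) ->
           I i (push A s) = I i s),
        (forall s, U s ->
           row_free (\matrix_(i < m, k < 5) ('D_(delta_mx 0 k) (I i) s : R))) &
        w = U `&` [set s | forall i, I i s = c i]].

Lemma ord2P (i : 'I_2) : i = inord 0 \/ i = inord 1.
Proof.
by case: i => [[|[|]] // p]; [left|right]; apply/val_inj; rewrite /= inordK.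
Qed.

Lemma sum2 (f : 'I_2 -> R) : \sum_i f i = f (inord 0) + f (inord 1).
Proof.
by rewrite !big_ord_recl big_ord0 addr0; congr (f _ + f _);
  apply/val_inj; rewrite /= inordK.
Qed.

Lemma formE (s : S4) (p : 'rV[R]_2) :
  let a (k : nat) : R := s 0 (inord k) in
  let x := p 0 (inord 0) in let y := p 0 (inord 1) in
  form s p = a 0%N * x ^+ 4 + 4 * a 1%N * x ^+ 3 * y
    + 6 * a 2%N * x ^+ 2 * y ^+ 2 + 4 * a 3%N * x * y ^+ 3 + a 4%N * y ^+ 4.
Proof. by rewrite /form !sum2 /tens !inordK //=; ring. Qed.

Lemma tens_push (A : 'M[R]_2) (s : S4) (i j k l : 'I_2) :
  tens (push A s) i j k l = \sum_a \sum_b \sum_c \sum_d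
    tens s a b c d * A a i * A b j * A c k * A d l.
Proof.
by rewrite {1}/tens mxE;
  case: (ord2P i) => ->; case: (ord2P j) => ->; case: (ord2P k) => ->;
  case: (ord2P l) => ->; rewrite !inordK //= !sum2 /tens !inordK //=; ring.
Qed.

Lemma tens_gl_act (B : 'M[R]_2) (s : S4) (i j k l : 'I_2) :
  tens (gl_act B s) i j k l = \sum_a
    (tens s a j k l * B a i + tens s i a k l * B a j
     + tens s i j a l * B a k + tens s i j k a * B a l).
Proof.
by rewrite {1}/tens mxE;
  case: (ord2P i) => ->; case: (ord2P j) => ->; case: (ord2P k) => ->;
  case: (ord2P l) => ->; rewrite !inordK //= !sum2 /tens !inordK //=; ring.
Qed.

(* Normalisation check: for b (x - r_1 y) ... (x - r_4 y), the discriminant is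
   b^6 times the product of the (r_i - r_j)^2 over i < j. *)
Lemma disc_split (s : S4) (b r1 r2 r3 r4 : R) :
  (forall p : 'rV[R]_2, let x := p 0 (inord 0) in let y := p 0 (inord 1) in
     form s p = b * (x - r1 * y) * (x - r2 * y) * (x - r3 * y) * (x - r4 * y)) ->
  disc s = b ^+ 6 * ((r1 - r2) * (r1 - r3) * (r1 - r4) * (r2 - r3)
                     * (r2 - r4) * (r3 - r4)) ^+ 2.
Proof.
move=> E.
pose p (u v : R) : 'rV[R]_2 := \row_j (if j == inord 0 then u else v).
have p0 u v : p u v 0 (inord 0) = u by rewrite mxE eqxx.
have p1 u v : p u v 0 (inord 1) = v.
  by rewrite mxE -val_eqE /= !inordK.
have := E (p 1 0); have := E (p 0 1); have := E (p 1 1); have := E (p 1 (-1)).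
have := E (p 2 1); rewrite !formE !p0 !p1 {E} /disc.
set a0 := s _ (inord 0); set a1 := s _ (inord 1); set a2 := s _ (inord 2).
set a3 := s _ (inord 3); set a4 := s _ (inord 4) => E1 E2 E3 E4 E5.
have -> : a0 = b by lra.
have -> : a4 = b * (r1 * r2 * r3 * r4) by lra.
have -> : a2 = b * (r1 * r2 + r1 * r3 + r1 * r4 + r2 * r3 + r2 * r4 + r3 * r4) / 6.
  by lra.
have -> : a1 = - b * (r1 + r2 + r3 + r4) / 4 by lra.
have -> : a3 = - b * (r1 * r2 * r3 + r1 * r2 * r4 + r1 * r3 * r4 + r2 * r3 * r4) / 4.
  by lra.
by field.
Qed.

End Quartics.

(* A smooth atlas of dimension 2 on M. The maps [coord i] and [param i] are
   total, but only their restrictions to [dom i] and [coord i @` dom i], which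
   are inverse to each other, are meaningful. *)
Record atlas (R : realType) (M : topologicalType) := Atlas {
  chart :> Type ;
  dom : chart -> set M ;
  coord : chart -> M -> 'rV[R]_2 ;
  param : chart -> 'rV[R]_2 -> M ;
  dom_open : forall i, open (dom i) ;
  dom_cover : forall q, exists i, dom i q ;
  image_open : forall i, open (coord i @` dom i) ;
  coordK : forall i q, dom i q -> param i (coord i q) = q ;
  coord_continuous : forall i q, dom i q -> {for q, continuous (coord i)} ;
  param_continuous : forall i q, dom i q ->
    {for coord i q, continuous (param i)} ;
  transition_smooth : forall i j,
    smooth (coord i @` (dom i `&` dom j)) (coord j \o param i)
}.

Section Surface.
Variables (R : realType) (M : topologicalType) (A : atlas R M).

(* Jacobian matrix at q of the change of coordinates from i to j; its a-th row
   contains the components in the chart j of the a-th coordinate vector of i. *)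
Definition jac (i j : A) (q : M) : 'M[R]_2 :=
  'J (coord j \o param i) (coord i q).

(* An atlas with this property is the datum of an orientation. *)
Definition oriented : Prop :=
  forall (i j : A) q, dom i q -> dom j q -> 0 < \det (jac i j q).

Definition smooth_fun (U : set M) (f : M -> R) : Prop :=
  forall i : A, smooth (coord i @` (U `&` dom i)) ((f \o param i) : _ -> R^o).

(* Fields are given by their components in all the charts: the value of X i at
   q is meaningful if q is in [dom i]. Two fields are the same on U if they are
   related by [same_on]. *)
Definition field (T : Type) := A -> M -> T.

Definition same_on (T : Type) (U : set M) (X Y : field T) : Prop :=
  forall i q, U q -> dom i q -> X i q = Y i q.

Definition smooth_field (n : nat) (U : set M) (X : field 'rV[R]_n.+1) : Prop :=
  forall i, smooth (coord i @` (U `&` dom i)) (X i \o param i).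

Definition vector_field (U : set M) (X : field 'rV[R]_2) : Prop :=
  smooth_field U X /\
  forall i j q, U q -> dom i q -> dom j q -> X j q = X i q *m jac i j q.

Definition symbol (s : field (S4 R)) : Prop :=
  smooth_field setT s /\
  forall i j q, dom i q -> dom j q -> s j q = push (jac i j q) (s i q).

Definition regular_symbol (s : field (S4 R)) : Prop :=
  forall i q, dom i q -> disc (s i q) != 0.

(* In the coordinate basis of the chart i, the linear isomorphisms from the
   tangent space at q to R^2 are the maps v |-> v *m B with B invertible. *)
Definition has_constant_type (w : set (S4 R)) (s : field (S4 R)) : Prop :=
  forall i q, dom i q -> forall B, B \in unitmx -> w (push B (s i q)).

Definition constant_type (s : field (S4 R)) : Prop :=
  exists2 w, regular_orbit w & has_constant_type w s.

(* Derivative along X of a function f with values in 'rV_n or in R. *)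
Definition lie (W : normedModType R) (X : field 'rV[R]_2) (f : M -> W) :
    field W :=
  fun i q => 'D_(X i q) (f \o param i) (coord i q).

(* The a-th coordinate vector field of the chart i, defined on [dom i]. *)
Definition frame (i : A) (a : 'I_2) : field 'rV[R]_2 :=
  fun j q => row a (jac i j q).

(* A linear connection in the tangent bundle, as a covariant derivative acting
   on the vector fields defined on open sets, compatibly with restrictions. *)
Record connection := Connection {
  nabla :> field 'rV[R]_2 -> field 'rV[R]_2 -> field 'rV[R]_2 ;
  nabla_field : forall U X Y, open U -> vector_field U X -> vector_field U Y ->
    vector_field U (nabla X Y) ;
  nabla_local : forall U X X' Y Y', open U ->
    vector_field U X -> vector_field U Y -> same_on U X X' -> same_on U Y Y' ->
    same_on U (nabla X Y) (nabla X' Y') ;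
  nabla_linear : forall U f X X' Y, open U -> smooth_fun U f ->
    vector_field U X -> vector_field U X' -> vector_field U Y ->
    same_on U (nabla (fun i q => f q *: X i q + X' i q) Y)
              (fun i q => f q *: nabla X Y i q + nabla X' Y i q) ;
  nabla_additive : forall U X Y Y', open U ->
    vector_field U X -> vector_field U Y -> vector_field U Y' ->
    same_on U (nabla X (fun i q => Y i q + Y' i q))
              (fun i q => nabla X Y i q + nabla X Y' i q) ;
  nabla_leibniz : forall U f X Y, open U -> smooth_fun U f ->
    vector_field U X -> vector_field U Y ->
    same_on U (nabla X (fun i q => f q *: Y i q))
      (fun i q => lie X (f : M -> R^o) i q *: Y i q + f q *: nabla X Y i q)
}.

(* With d_0, d_1 the coordinate fields of the chart i and s the sum of the
   s^{jklm} d_j.d_k.d_l.d_m, the Leibniz rule gives nabla_X s as the sum of the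
   X(s^{jklm}) d_j.d_k.d_l.d_m and of the terms in which some d_a is replaced
   by nabla_X d_a. *)
Definition nabla_symbol (D : connection) (X : field 'rV[R]_2)
    (s : field (S4 R)) : field (S4 R) :=
  fun i q => lie X (s i) i q
    + gl_act (\matrix_a D X (frame i a) i q) (s i q).

End Surface.

(* Main.v *)
(* For a binary quartic s let i2 and i3 be its invariants of degrees 2 and 3. The
   covector 3 i3 di2 - 2 i2 di3 at s annihilates the tangent space of the orbit
   of s, and its value on the Hessian of s is a nonzero multiple of the
   discriminant. Hence, if disc s != 0, then gl(V) -> S^4(V), B |-> gl_act B s, is
   injective, with image the kernel of this covector.

   If s has constant type, the derivatives of its components are tangent to the
   orbits; injectivity gives unique Christoffel matrices solving nabla s = 0, and
   uniqueness gives their transformation law, so that no partition of unity is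
   needed. Conversely, if nabla s = 0, the derivatives of s are tangent to the
   orbits (bump functions provide enough global vector fields), so that
   i2 / |i3|^(2/3) or i3 / |i2|^(3/2) is locally constant. Near s each level set
   of such a function lies in one orbit, which makes the orbit of s locally
   constant, hence constant, and also makes it regular. *)

Require Import Defs.
From HB Require Import structures.
From mathcomp Require Import all_boot all_order all_algebra.
From mathcomp Require Import all_classical all_reals all_analysis.
From mathcomp Require Import ring lra.
Set Implicit Arguments.
Unset Strict Implicit.
Unset Printing Implicit Defensive.
Import Order.TTheory GRing.Theory Num.Theory.
Import numFieldNormedType.Exports.
Local Open Scope classical_set_scope.
Local Open Scope ring_scope.

Local Notation coord := Defs.coord.

(** * Smooth maps *)

(** The quotient i2^3 / i3^2 is invariant too, but its differential is the covector times i2^2 /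
    i3^3 and dies where i2 = 0; likewise that of i3^2 / i2^3 dies where i3 = 0. Extracting a root
    removes the extra factor. Since i2 and i3 have no common zero where disc s != 0, one of the two
    fractional expressions always has a nonvanishing differential near s. Both weights are even, so
    the sign of [\det A] is harmless. Globally a level set can contain several orbits: x^4 + y^4 and
    - x^4 - y^4 have the same i2 and i3, but no real change of variables exchanges them. So level
    sets and orbits are compared near one point only, and the result is spread by the group. The
    local comparison rests on compactness and the mean value theorem: t is compared with a nearest
    point of a small compact piece of the orbit of s. *)

Lemma near_eq_differentiable (R : numFieldType) (V W : normedModType R)
    (f g : V -> W) (x : V) :
  (\near x, f x = g x) -> differentiable f x -> differentiable g x.
Proof.
move=> fg /diff_locallyP[cf ef].
have eg : g \o shift x = cst (g x) + 'd f x +o_ 0 id.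
  apply/eqaddoP => e e0; move/eqaddoP : ef => /(_ e e0).
  have : \forall y \near 0, f (y + x) = g (y + x).
    move: fg; rewrite (near_shift 0) /= => fg.
    by apply: filterS fg => y /=; rewrite subr0.
  apply: filterS2 => y /= fgy.
  by rewrite !fctE /= fgy (nbhs_singleton fg).
by apply/diff_locallyP; rewrite (diff_unique cf eg).
Qed.

Lemma is_derive_comp1 (R : realType) (V : normedModType R) (f : V -> R^o)
    (g : R^o -> R^o) (x v : V) (a b : R^o) :
  differentiable f x -> is_derive x v f a -> is_derive (f x) 1 g b ->
  is_derive x v (g \o f) (b * a).
Proof.
move=> df [_ <-] [dg <-]; have {}dg : differentiable g (f x) by apply/derivable1_diffP.
have dgf : differentiable (g \o f) x by exact: differentiable_comp.
split; first exact: diff_derivable.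
rewrite (deriveE _ dgf) (deriveE _ df) (deriveE _ dg) diff_comp //=.
have -> : 'd g (f x) ('d f x v) = 'd g (f x) ('d f x v *: (1 : R^o)).
  by rewrite [_ *: _]mulr1.
by rewrite linearZ /= mulrC.
Qed.

Section CkTheory.
Variables (R : realType) (V : normedModType R).

Section General.
Variable W : normedModType R.
Implicit Types (U : set V) (f g : V -> W) (k : nat).

Lemma Ck_sub k U U' f : U' `<=` U -> Ck k U f -> Ck k U' f.
Proof.
move=> UU'; elim: k f => [|k IH] f /= => [cf x /UU' /cf //|[df Df]].
by split=> [x /UU' /df //|v]; exact: IH.
Qed.

(** The pieces [U'] need not be open, because [Ck] imposes its conditions point by point. Bump
    fields use this, being smooth for different reasons inside and outside a chart. *)
Lemma Ck_local k U f :
  (forall x, U x -> exists2 U', U' x & Ck k U' f) -> Ck k U f.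
Proof.
elim: k f => [|k IH] f /= H.
  by move=> x /H[U' Ux]; exact.
split=> [x /H[U' Ux [+ _]]|v]; first exact.
by apply: IH => x /H[U' Ux [_ /(_ v)]]; exists U'.
Qed.

Lemma CkW k U f : Ck k.+1 U f -> Ck k U f.
Proof.
elim: k f => [|k IH] f [df Df].
  by move=> x /df /differentiable_continuous.
by split=> // v; exact: IH.
Qed.

Lemma eq_Ck k U f g : open U -> (forall x, U x -> f x = g x) ->
  Ck k U f -> Ck k U g.
Proof.
move=> oU; have nU x : U x -> nbhs x U by move=> Ux; exact: open_nbhs_nbhs.
elim: k f g => [|k IH] f g fg /=.
  move=> cf x Ux; rewrite /prop_for /continuous_at -fg //.
  apply: cvg_trans (cf x Ux); apply: near_eq_cvg.
  by apply: filterS (nU x Ux) => y; exact: fg.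
have nfg x : U x -> \near x, f x = g x.
  by move=> /nU; apply: filterS => y; exact: fg.
move=> [df Df]; split=> [x Ux|v].
  by apply: near_eq_differentiable (nfg x Ux) (df x Ux).
apply: IH (Df v) => x Ux; exact: near_eq_derive (nfg x Ux).
Qed.

Lemma Ck_cst k U (c : W) : Ck k U (fun=> c).
Proof.
elim: k c => [|k IH] c /=; first by move=> x _; exact: cst_continuous.
split=> [x _|v]; first exact: differentiable_cst.
rewrite (_ : 'D_v (fun=> c) = fun=> 0); first exact: IH.
by apply/funext => x; exact: derive_cst.
Qed.

Lemma CkD k U f g : open U -> Ck k U f -> Ck k U g ->
  Ck k U (fun x => f x + g x).
Proof.
move=> oU; elim: k f g => [|k IH] f g /=.
  by move=> cf cg x Ux; apply: continuousD; [exact: cf|exact: cg].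
move=> [df Df] [dg Dg]; split=> [x Ux|v].
  by apply: differentiableD; [exact: df|exact: dg].
apply: eq_Ck (IH _ _ (Df v) (Dg v)) => // x Ux.
by rewrite deriveD //; apply: diff_derivable; [exact: df|exact: dg].
Qed.

Lemma Ck_sum k U (I : Type) (r : seq I) (P : pred I) (F : I -> V -> W) :
  open U -> (forall i, Ck k U (F i)) ->
  Ck k U (fun x => \sum_(i <- r | P i) F i x).
Proof.
move=> oU CF; elim: r => [|i r IH].
  by under eq_fun do rewrite big_nil; exact: Ck_cst.
under eq_fun do rewrite big_cons.
by case: (P i) => //; exact: CkD.
Qed.

End General.

Section Scalar.
Implicit Types (U : set V) (f g : V -> R^o) (k : nat).

Lemma CkM k U f g : open U -> Ck k U f -> Ck k U g ->
  Ck k U ((fun x => f x * g x) : V -> R^o).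
Proof.
move=> oU; elim: k f g => [|k IH] f g.
  by move=> cf cg x Ux; apply: continuousM; [exact: cf|exact: cg].
move=> Cf Cg; have [[df Df] [dg Dg]] := (Cf, Cg); split=> [x Ux|v].
  by apply: differentiableM; [exact: df|exact: dg].
have := CkD oU (IH _ _ (CkW Cf) (Dg v)) (IH _ _ (CkW Cg) (Df v)).
apply: eq_Ck => // x Ux.
by rewrite deriveM //; apply: diff_derivable; [exact: df|exact: dg].
Qed.

Lemma Ck_prod k U (I : Type) (r : seq I) (P : pred I) (F : I -> V -> R^o) :
  open U -> (forall i, Ck k U (F i)) ->
  Ck k U ((fun x => \prod_(i <- r | P i) F i x) : V -> R^o).
Proof.
move=> oU CF; elim: r => [|i r IH].
  by under eq_fun do rewrite big_nil; exact: Ck_cst.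
under eq_fun do rewrite big_cons.
by case: (P i) => //; exact: CkM.
Qed.

(** The induction on [k] replaces [g] by its derivative, so it must run over a class [P] closed
    under differentiation on [D]: multiples of real powers on the positive half-line, and the span
    of the flat functions used for bumps. *)
Lemma Ck_comp1 (D : set R) (P : (R -> R) -> Prop) k U f (g : R -> R) :
  open U -> (forall x, U x -> D (f x)) ->
  (forall h, P h -> exists2 h', P h' & forall t, D t -> is_derive t 1 (h : R^o ->
    R^o) (h' t)) ->
  Ck k U f -> P g -> Ck k U ((fun x => g (f x)) : V -> R^o).
Proof.
move=> oU UD PD; elim: k f g UD => [|k IH] f g UD Cf Pg.
  move=> x Ux; have [h' _ dg] := PD g Pg.
  have := dg _ (UD x Ux) => -[/derivable1_diffP /differentiable_continuous cg _].
  by apply: (@continuous_comp _ _ _ f g) => //; exact: Cf.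
have [h' Ph' dg] := PD g Pg; have [df Df] := Cf.
have diffg x : U x -> differentiable (g : R^o -> R^o) (f x).
  by move=> Ux; have [/derivable1_diffP] := dg _ (UD x Ux).
split=> [x Ux|v].
  by apply: (@differentiable_comp _ _ _ _ f (g : R^o -> R^o)); [exact: df|exact: diffg].
have := CkM oU (IH _ _ UD (CkW Cf) Ph') (Df v); apply: eq_Ck => // x Ux.
have dfx : is_derive x v f ('D_v f x) by apply/derivableP/diff_derivable/df.
have [_ e] := is_derive_comp1 (df x Ux) dfx (dg _ (UD x Ux)).
by rewrite [RHS]e.
Qed.

End Scalar.
End CkTheory.

Section CkMatrix.
Variables (R : realType) (V : normedModType R).
Implicit Type (U : set V).

Lemma differentiable_mx m n (f : V -> 'M[R]_(m.+1, n.+1)) (x : V) :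
  (forall i j, differentiable ((fun y => f y i j) : V -> R^o) x) ->
  differentiable f x.
Proof.
move=> df; have -> : f = \sum_i \sum_j (fun y => f y i j *: delta_mx i j).
  apply/funext => y; rewrite fct_sumE [LHS]matrix_sum_delta.
  by apply: eq_bigr => i _; rewrite fct_sumE.
apply: differentiable_sum => i; apply: differentiable_sum => j.
by apply: differentiableZl; exact: df.
Qed.

Lemma differentiable_entry m n (f : V -> 'M[R]_(m.+1, n.+1)) (x : V) i j :
  differentiable f x -> differentiable ((fun y => f y i j) : V -> R^o) x.
Proof.
move=> df; pose g (M : 'M[R]_(m.+1, n.+1)) : R^o := M i j.
apply: (@differentiable_comp _ _ _ _ f g x df).
exact: (@differentiable_coord R m.+1 n.+1 (f x) i j).
Qed.

Lemma derive_entry m n (f : V -> 'M[R]_(m.+1, n.+1)) (x v : V) i j :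
  differentiable f x -> ('D_v f x) i j = 'D_v ((fun y => f y i j) : V -> R^o) x.
Proof.
by move=> df; rewrite derive_mx ?mxE //; exact: diff_derivable.
Qed.

Lemma Ck_entry m n k U (f : V -> 'M[R]_(m.+1, n.+1)) i j : open U ->
  Ck k U f -> Ck k U ((fun y => f y i j) : V -> R^o).
Proof.
move=> oU; elim: k f => [|k IH] f /=.
  move=> cf x Ux; pose g (M : 'M[R]_(m.+1, n.+1)) : R^o := M i j.
  apply: (@continuous_comp _ _ _ f g x (cf x Ux)).
  exact: (@coord_continuous _ m.+1 n.+1).
move=> [df Df]; split=> [x Ux|v]; first exact/differentiable_entry/df.
apply: eq_Ck (IH _ (Df v)) => // x Ux; rewrite derive_entry //; exact: df.
Qed.

Lemma Ck_mx m n k U (f : V -> 'M[R]_(m.+1, n.+1)) : open U ->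
  (forall i j, Ck k U ((fun y => f y i j) : V -> R^o)) -> Ck k U f.
Proof.
move=> oU; elim: k f => [|k IH] f Cf.
  have -> : f = (fun y => \sum_i \sum_j (f y i j *: delta_mx i j)).
    by apply/funext => y; rewrite [LHS]matrix_sum_delta.
  do 2![apply: Ck_sum => // ?].
  by move=> x Ux; apply: cvgZr_tmp; exact: Cf.
have df x : U x -> differentiable f x.
  by move=> Ux; apply: differentiable_mx => i j; have [df _] := Cf i j; exact: df.
split=> // v; apply: IH => i j; have [_ /(_ v)] := Cf i j.
by apply: eq_Ck => // x /df dfx; rewrite derive_entry.
Qed.

End CkMatrix.

Section SmoothTheory.
Variables (R : realType) (V : normedModType R) (U : set V).
Hypothesis oU : open U.
Implicit Types (f g : V -> R^o).

Lemma smooth_cst (W : normedModType R) (c : W) : smooth U (fun=> c).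
Proof. by move=> k; exact: Ck_cst. Qed.

Lemma smoothD f g : smooth U f -> smooth U g ->
  smooth U ((fun x => f x + g x) : V -> R^o).
Proof. by move=> sf sg k; exact: CkD. Qed.

Lemma smoothM f g : smooth U f -> smooth U g ->
  smooth U ((fun x => f x * g x) : V -> R^o).
Proof. by move=> sf sg k; exact: CkM. Qed.

Lemma smoothX f n : smooth U f -> smooth U ((fun x => f x ^+ n) : V -> R^o).
Proof.
move=> sf; elim: n => [|n IH]; first exact: smooth_cst.
by under eq_fun do rewrite exprS; exact: smoothM.
Qed.

Lemma smoothN f : smooth U f -> smooth U ((fun x => - f x) : V -> R^o).
Proof.
by move=> sf; under eq_fun do rewrite -mulN1r; apply: smoothM => //; exact: smooth_cst.
Qed.

Lemma smoothB f g : smooth U f -> smooth U g ->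
  smooth U ((fun x => f x - g x) : V -> R^o).
Proof. by move=> sf sg; apply: smoothD => //; exact: smoothN. Qed.

Lemma smooth_sum (I : Type) (r : seq I) (P : pred I) (F : I -> V -> R^o) :
  (forall i, smooth U (F i)) ->
  smooth U ((fun x => \sum_(i <- r | P i) F i x) : V -> R^o).
Proof. by move=> sF k; apply: Ck_sum => // i; exact: sF. Qed.

Lemma smooth_prod (I : Type) (r : seq I) (P : pred I) (F : I -> V -> R^o) :
  (forall i, smooth U (F i)) ->
  smooth U ((fun x => \prod_(i <- r | P i) F i x) : V -> R^o).
Proof. by move=> sF k; apply: Ck_prod => // i; exact: sF. Qed.

Lemma smooth_powR f (p : R) : (forall x, U x -> 0 < f x) ->
  smooth U f -> smooth U ((fun x => f x `^ p) : V -> R^o).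
Proof.
move=> f0 sf k.
pose P (h : R -> R) := exists c q : R, h = fun t => c * t `^ q.
have := @Ck_comp1 R V [set t | 0 < t] P k U f (fun t => t `^ p) oU f0 _ (sf k).
apply.
- move=> _ [c [q ->]]; exists (fun t => c * q * t `^ (q - 1));
  first by exists (c * q), (q - 1).
  move=> t t0; have dt := is_derive1_powR q t0.
  have := is_deriveZ c dt.
  by rewrite /GRing.scale /= mulrA.
- by exists 1, p; apply/funext => t; rewrite mul1r.
Qed.

Lemma smooth_inv f : (forall x, U x -> f x != 0) ->
  smooth U f -> smooth U ((fun x => (f x)^-1) : V -> R^o).
Proof.
move=> f0 sf.
(* Real powers are differentiated at positive arguments only, so 1 / f is written as f times the
   power -1 of f^2, which covers both signs of f. *)
have sq : smooth U ((fun x => (f x ^+ 2) `^ (- 1)) : V -> R^o).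
  apply: smooth_powR; last exact: smoothX.
  by move=> x /f0 fx0; rewrite exprn_even_gt0.
move=> k; apply: eq_Ck (smoothM sf sq k) => // x Ux.
by rewrite powR_inv1 ?sqr_ge0 // expr2 invfM mulrA divff ?mul1r ?f0.
Qed.

Lemma smooth_mx m n (f : V -> 'M[R]_(m.+1, n.+1)) :
  (forall i j, smooth U ((fun y => f y i j) : V -> R^o)) -> smooth U f.
Proof. by move=> sf k; apply: Ck_mx => // i j; exact: sf. Qed.

Lemma smooth_entry m n (f : V -> 'M[R]_(m.+1, n.+1)) i j :
  smooth U f -> smooth U ((fun y => f y i j) : V -> R^o).
Proof. by move=> sf k; exact/Ck_entry. Qed.

Lemma eq_smooth (W : normedModType R) (f g : V -> W) :
  (forall x, U x -> f x = g x) -> smooth U f -> smooth U g.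
Proof. by move=> fg sf k; apply: eq_Ck (sf k). Qed.

Lemma smooth_differentiable (W : normedModType R) (f : V -> W) x :
  smooth U f -> U x -> differentiable f x.
Proof. by move=> /(_ 1%N)[df _]; exact: df. Qed.

Lemma smooth_continuous (W : normedModType R) (f : V -> W) x :
  smooth U f -> U x -> {for x, continuous f}.
Proof. by move=> /(_ 0%N); exact. Qed.

Lemma smooth_derive (W : normedModType R) (f : V -> W) v :
  smooth U f -> smooth U ('D_v f).
Proof. by move=> sf k; have [_] := sf k.+1; exact. Qed.

Lemma smooth_mulmx m n p (F : V -> 'M[R]_(m.+1, n.+1)) (G : V -> 'M[R]_(n.+1, p.+1)) :
  smooth U F -> smooth U G -> smooth U (fun x => F x *m G x).
Proof.
move=> sF sG; apply: smooth_mx => i j; under eq_fun do rewrite mxE.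
by apply: smooth_sum => l; apply: smoothM; exact: smooth_entry.
Qed.

Lemma smooth_addmx m n (F G : V -> 'M[R]_(m.+1, n.+1)) :
  smooth U F -> smooth U G -> smooth U (fun x => F x + G x).
Proof.
by move=> sF sG k; apply: CkD.
Qed.

Lemma smooth_scalemx m n f (F : V -> 'M[R]_(m.+1, n.+1)) :
  smooth U f -> smooth U F -> smooth U (fun x => f x *: F x).
Proof.
move=> sf sF; apply: smooth_mx => i j; under eq_fun do rewrite mxE.
by apply: smoothM => //; exact: smooth_entry.
Qed.

Lemma smooth_det n (F : V -> 'M[R]_n) :
  (forall i j, smooth U ((fun y => F y i j) : V -> R^o)) ->
  smooth U ((fun x => \det (F x)) : V -> R^o).
Proof.
move=> sF; apply: smooth_sum => s; apply: smoothM; first exact: smooth_cst.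
by apply: smooth_prod => i; exact: sF.
Qed.

Lemma smooth_invmx n (F : V -> 'M[R]_n.+1) : (forall x, U x -> F x \in unitmx) ->
  smooth U F -> smooth U (fun x => invmx (F x)).
Proof.
move=> uF sF; apply: (@eq_smooth _ (fun x => (\det (F x))^-1 *: \adj (F x))).
  by move=> x Ux; rewrite /invmx uF.
apply: smooth_scalemx.
  apply: smooth_inv; last by apply: smooth_det => i j; exact: smooth_entry.
  by move=> x /uF; rewrite unitmxE unitfE.
apply: smooth_mx => i j; under eq_fun do rewrite mxE /cofactor.
apply: smoothM; first exact: smooth_cst.
apply: smooth_det => a b; under eq_fun do rewrite !mxE.
exact: smooth_entry.
Qed.

End SmoothTheory.

Lemma is_derive_entry (R : realType) n (i : 'I_n.+1) (v x : 'rV[R]_n.+1) :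
  'D_v ((fun y : 'rV[R]_n.+1 => y 0 i) : _ -> R^o) x = v 0 i.
Proof. by rewrite -(@derive_entry _ _ 0 n id) ?derive_id //;
  exact: differentiable_id. Qed.

Lemma smooth_coord (R : realType) n (U : set 'rV[R]_n.+1) (i : 'I_n.+1) :
  smooth U ((fun y : 'rV[R]_n.+1 => y 0 i) : _ -> R^o).
Proof.
case=> [|k]; first by move=> x _; exact: coord_continuous.
split=> [x _|v]; first exact: (@differentiable_coord R 1 n.+1 x 0 i).
have -> : 'D_v ((fun y : 'rV[R]_n.+1 => y 0 i) : _ -> R^o) = fun=> v 0 i.
  by apply/funext => x; exact: is_derive_entry.
exact: Ck_cst.
Qed.

Lemma derive_rowE (R : realType) n (W : normedModType R) (f : 'rV[R]_n.+1 -> W) v x :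
  differentiable f x -> 'D_v f x = \sum_a v 0 a *: 'D_(delta_mx 0 a) f x.
Proof.
move=> df; rewrite deriveE // {1}(row_sum_delta v) linear_sum.
by apply: eq_bigr => a _; rewrite linearZ deriveE.
Qed.

(** [Ck] controls derivatives in fixed directions. A moving direction is expanded in the standard
    basis, and its entries become smooth coefficients. *)
Lemma smooth_derive_along (R : realType) n m p (U : set 'rV[R]_n.+1)
    (f : 'rV[R]_n.+1 -> 'M[R]_(m.+1, p.+1)) (X : 'rV[R]_n.+1 -> 'rV[R]_n.+1) :
  open U -> smooth U f -> smooth U X -> smooth U (fun x => 'D_(X x) f x).
Proof.
move=> oU sf sX; pose g x := \sum_a X x 0 a *: 'D_(delta_mx 0 a) f x.
apply: (@eq_smooth _ _ _ oU _ g) => [x Ux|].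
  by rewrite [RHS]derive_rowE //; exact: smooth_differentiable Ux.
move=> k; apply: Ck_sum => // a; apply: (smooth_scalemx oU); first exact: smooth_entry.
exact: smooth_derive.
Qed.

(** * Binary quartics *)

(** Cofactor expansion along the first row, with entries indexed by [nat]: for an explicit size it
    simplifies to a polynomial expression that [ring] and [field] can handle. *)
Fixpoint laplace (R : comNzRingType) n (f : nat -> nat -> R) : R :=
  if n is m.+1 then
    foldr (fun j => +%R ((-1) ^+ j * f 0%N j *
        laplace m (fun i l => f i.+1 (bump j l)))) 0 (iota 0 n)
  else 1.

Lemma det_laplace (R : comNzRingType) n (f : nat -> nat -> R) :
  \det (\matrix_(i < n, j < n) f i j) = laplace n f.
Proof.
elim: n f => [|n IH] f; first exact: det_mx00.
pose F j := (-1) ^+ j * f 0%N j * laplace n (fun i l => f i.+1 (bump j l)).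
rewrite (expand_det_row _ ord0); transitivity (\sum_(j < n.+1) F j).
  apply: eq_bigr => j _; rewrite mxE /cofactor /F -IH add0n mulrA [f _ _ * _]mulrC.
  by congr (_ * \det _); apply/matrixP => i l; rewrite !mxE /bump.
by rewrite -(big_mkord xpredT F) unlock.
Qed.

Section QuarticInvariants.
Variable R : realType.
Implicit Types (s v : S4 R) (A B C : 'M[R]_2).

Local Notation a s k := (s 0 (inord k)).

Lemma ord5_ind (P : 'I_5 -> Prop) :
  P (inord 0) -> P (inord 1) -> P (inord 2) -> P (inord 3) -> P (inord 4) ->
  forall i, P i.
Proof.
move=> P0 P1 P2 P3 P4 i; rewrite -(inord_val i).
by case: i => [[|[|[|[|[|]]]]] //].
Qed.

Lemma sum5 (f : 'I_5 -> R) : \sum_i f i =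
  f (inord 0) + f (inord 1) + f (inord 2) + f (inord 3) + f (inord 4).
Proof.
rewrite !big_ord_recl big_ord0 addr0 !addrA.
by congr (f _ + f _ + f _ + f _ + f _); apply/val_inj; rewrite /= inordK.
Qed.

(** [i2] and [i3] are the classical invariants I and J of a binary quartic, in the normalisation
    with binomial coefficients. *)
Definition i2 s : R := a s 0 * a s 4 - 4 * a s 1 * a s 3 + 3 * a s 2 ^+ 2.

Definition i3 s : R := a s 0 * a s 2 * a s 4 + 2 * a s 1 * a s 2 * a s 3
  - a s 2 ^+ 3 - a s 0 * a s 3 ^+ 2 - a s 1 ^+ 2 * a s 4.

Definition di2 s v : R := a s 0 * a v 4 + a v 0 * a s 4
  - 4 * (a s 1 * a v 3 + a v 1 * a s 3) + 6 * a s 2 * a v 2.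

Definition di3 s v : R :=
  a v 0 * (a s 2 * a s 4 - a s 3 ^+ 2) + 2 * a v 1 * (a s 2 * a s 3 - a s 1 * a s 4)
  + a v 2 * (a s 0 * a s 4 + 2 * a s 1 * a s 3 - 3 * a s 2 ^+ 2)
  + 2 * a v 3 * (a s 1 * a s 2 - a s 0 * a s 3) + a v 4 * (a s 0 * a s 2 - a s 1 ^+ 2).

(** The differential of i2^3 / i3^2 with its factor i2^2 / i3^3 cleared. *)
Definition conormal s v : R := 3 * i3 s * di2 s v - 2 * i2 s * di3 s v.

(** Components of the Hessian determinant of the form divided by 144, again with binomial
    coefficients taken out. *)
Definition hess s : S4 R := \row_(j < 5)
  [:: a s 0 * a s 2 - a s 1 ^+ 2; (a s 0 * a s 3 - a s 1 * a s 2) / 2;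
      (a s 0 * a s 4 + 2 * a s 1 * a s 3 - 3 * a s 2 ^+ 2) / 6;
      (a s 1 * a s 4 - a s 2 * a s 3) / 2; a s 2 * a s 4 - a s 3 ^+ 2]`_j.

(* Rows: the images of s under the elementary matrices, then the Hessian of s,
   which is transverse to the orbit. The entries s_(-1) and s_5 are junk, with
   coefficient 0. *)
Definition orbit_frame s : 'M[R]_5 := \matrix_(i < 5, j < 5)
  [:: (4 - j)%:R * a s j; j%:R * a s j.-1; (4 - j)%:R * a s j.+1; j%:R * a s j;
      hess s 0 j]`_i.

Lemma discE s : disc s = 256 * (i2 s ^+ 3 - 27 * i3 s ^+ 2).
Proof. by []. Qed.

Lemma gl_actE B s j : (gl_act B s) 0 j =
  (4 - j)%:R * (a s j * B (inord 0) (inord 0) + a s j.+1 * B (inord 1) (inord 0))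
  + j%:R * (a s j.-1 * B (inord 0) (inord 1) + a s j * B (inord 1) (inord 1)).
Proof.
rewrite mxE sum2 /tens; move: j; apply: ord5_ind;
  rewrite !inordK //= ?(addn0, add0n, addnS, subn0, subSS); ring.
Qed.

(** Infinitesimal version of the weights 4 and 6 of [i2] and [i3] in the determinant. The
    coefficients 3 and 2 of [conormal] make the two trace terms cancel. *)
Lemma di2_gl_act B s : di2 s (gl_act B s) = 4 * \tr B * i2 s.
Proof. rewrite /di2 !gl_actE /mxtrace sum2 /i2 !inordK //= ?(subn0, subSS); ring. Qed.

Lemma di3_gl_act B s : di3 s (gl_act B s) = 6 * \tr B * i3 s.
Proof. rewrite /di3 !gl_actE /mxtrace sum2 /i3 !inordK //= ?(subn0, subSS); ring. Qed.

Lemma conormal_gl_act B s : conormal s (gl_act B s) = 0.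
Proof. rewrite /conormal di2_gl_act di3_gl_act; ring. Qed.

Lemma conormal_hess s : conormal s (hess s) = - disc s / 768.
Proof.
by rewrite discE /conormal /di2 /di3 /hess !mxE !inordK //= /i2 /i3; field.
Qed.

Lemma det_orbit_frame s : \det (orbit_frame s) = disc s / 96.
Proof.
pose f (i j : nat) := [:: (4 - j)%:R * a s j; j%:R * a s j.-1; (4 - j)%:R * a s j.+1;
  j%:R * a s j;
      [:: a s 0 * a s 2 - a s 1 ^+ 2; (a s 0 * a s 3 - a s 1 * a s 2) / 2;
      (a s 0 * a s 4 + 2 * a s 1 * a s 3 - 3 * a s 2 ^+ 2) / 6;
      (a s 1 * a s 4 - a s 2 * a s 3) / 2; a s 2 * a s 4 - a s 3 ^+ 2]`_j]`_i.
have -> : orbit_frame s = \matrix_(i < 5, j < 5) f i j.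
  by apply/matrixP => i j; rewrite !mxE.
rewrite det_laplace discE /i2 /i3 /= /f /bump /=.
rewrite ?(subn0, subSS).
by field.
Qed.

Lemma conormalD s v v' : conormal s (v + v') = conormal s v + conormal s v'.
Proof. rewrite /conormal /di2 /di3 !mxE; ring. Qed.

Lemma conormalZ s c v : conormal s (c *: v) = c * conormal s v.
Proof. rewrite /conormal /di2 /di3 !mxE; ring. Qed.
End QuarticInvariants.

(** * The action of GL(V) on quartics and its derivative *)

Section Action.
Variable R : realType.
Implicit Types (s v : S4 R) (A B C K : 'M[R]_2).
Local Notation a s k := (s 0 (inord k)).

(* Derivative of A |-> push A s in the direction K *)
Definition dpush A K s : S4 R :=
  untens (fun i j k l => \sum_a \sum_b \sum_c \sum_d tens s a b c d *
    (K a i * A b j * A c k * A d l + A a i * K b j * A c k * A d l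
     + A a i * A b j * K c k * A d l + A a i * A b j * A c k * K d l)).

Lemma tensK s : untens (tens s) = s.
Proof.
apply/rowP; apply: ord5_ind; rewrite mxE /tens !inordK //= ?(addn0, add0n, addnS) //.
Qed.

Lemma eq_untens (T T' : 'I_2 -> 'I_2 -> 'I_2 -> 'I_2 -> R) :
  (forall i j k l, T i j k l = T' i j k l) -> untens T = untens T'.
Proof. by move=> e; apply/rowP => m; rewrite !mxE. Qed.

Lemma push1 s : push 1%:M s = s.
Proof.
rewrite -[RHS]tensK; apply: eq_untens => i j k l.
have delta (F : 'I_2 -> R) x : \sum_y F y * (1%:M : 'M[R]_2) y x = F x.
  rewrite (bigD1 x) //= mxE eqxx mulr1 big1 ?addr0 // => y /negPf yx.
  by rewrite mxE yx mulr0.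
rewrite -[RHS](delta (fun a => tens s a j k l)); apply: eq_bigr => a _.
rewrite -[in RHS](delta (fun b => tens s a b k l)) mulr_suml; apply: eq_bigr => b _.
rewrite -[in RHS](delta (fun c => tens s a b c l)) !mulr_suml; apply: eq_bigr => c _.
rewrite -[in RHS](delta (fun d => tens s a b c d)) !mulr_suml; apply: eq_bigr => d _.
by ring.
Qed.

Lemma pushM A B s : push (A *m B) s = push B (push A s).
Proof.
apply: eq_untens => i j k l; rewrite !sum2 !tens_push !mxE !sum2.
set c := tens s; ring.
Qed.

(** Derivative at t = 0 of [push] along the curve (1 + t B) A; the next lemma uses the curve A (1 +
    t C). For row vectors the left factor acts first. *)
Lemma push_gl_act A B s : push A (gl_act B s) = dpush A (B *m A) s.
Proof.
apply: eq_untens => i j k l; rewrite !sum2 !tens_gl_act !mxE !sum2; ring.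
Qed.

Lemma gl_act_push A C s : gl_act C (push A s) = dpush A (A *m C) s.
Proof.
apply: eq_untens => i j k l; rewrite !sum2 !tens_push !mxE !sum2; ring.
Qed.

Lemma pushZ A c s : push A (c *: s) = c *: push A s.
Proof.
rewrite /push /untens; apply/rowP => m; rewrite !mxE !sum2 /tens !mxE; ring.
Qed.

Lemma gl_actD B C s : gl_act (B + C) s = gl_act B s + gl_act C s.
Proof. by apply/rowP => j; rewrite !mxE !sum2 !mxE; ring. Qed.

Lemma gl_actZ c B s : gl_act (c *: B) s = c *: gl_act B s.
Proof. by apply/rowP => j; rewrite !mxE !sum2 !mxE; ring. Qed.

Lemma gl_actN B s : gl_act (- B) s = - gl_act B s.
Proof. by rewrite -scaleN1r gl_actZ scaleN1r. Qed.

Lemma pushE A s (k : 'I_5) : (push A s) 0 k = tens (push A s)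
  (inord (0 < k)) (inord (1 < k)) (inord (2 < k)) (inord (3 < k)).
Proof.
rewrite /tens; congr (_ _ _); apply/val_inj.
by case: k => [[|[|[|[|[|]]]]] //= p]; rewrite !inordK.
Qed.

Lemma det_mx2 A : \det A = A (inord 0) (inord 0) * A (inord 1) (inord 1)
                           - A (inord 0) (inord 1) * A (inord 1) (inord 0).
Proof.
pose f (i j : nat) := A (inord i) (inord j).
have -> : A = \matrix_(i < 2, j < 2) f i j.
  by apply/matrixP => i j; rewrite mxE /f !inord_val.
by rewrite det_laplace /= /f /bump /= !mxE !inordK //=; ring.
Qed.

Lemma i2_push A s : i2 (push A s) = \det A ^+ 4 * i2 s.
Proof.
rewrite det_mx2 /i2 !pushE !tens_push !inordK //= !sum2 /tens !inordK //= ?(addn0,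
  add0n, addnS).
ring.
Qed.

End Action.

(** * Weight of the cubic invariant, and inversion of the infinitesimal action *)

Section Orbit.
Variable R : realType.
Implicit Types (s v : S4 R) (A B C K : 'M[R]_2).
Local Notation a s k := (s 0 (inord k)).

Lemma ord3_ind (P : 'I_3 -> Prop) :
  P (inord 0) -> P (inord 1) -> P (inord 2) -> forall i, P i.
Proof.
by move=> P0 P1 P2 i; rewrite -(inord_val i); case: i => [[|[|[|]]] //].
Qed.

Lemma sum3 (f : 'I_3 -> R) : \sum_i f i = f (inord 0) + f (inord 1) + f (inord 2).
Proof.
rewrite !big_ord_recl big_ord0 addr0 !addrA.
by congr (f _ + f _ + f _); apply/val_inj; rewrite /= inordK.
Qed.

(** The Hankel matrix of s, that is, s as a quadratic form on the symmetric square of the dual.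
    [push A] acts on it by congruence with S^2 A, so the weight of [i3] follows from
    multiplicativity of determinants instead of a large expansion. *)
Definition catalecticant s : 'M[R]_3 := \matrix_(i < 3, j < 3) a s (i + j).

Lemma det_catalecticant s : \det (catalecticant s) = i3 s.
Proof.
rewrite /catalecticant (det_laplace 3 (fun i j => a s (i + j))) /i3 /= /bump /=.
rewrite ?(addn0, add0n, addnS, addn1); ring.
Qed.

(* S^2 A, in the basis e_0^2, e_0.e_1, e_1^2 of S^2(V) *)
Definition sym_square A : 'M[R]_3 :=
  let x := A (inord 0) (inord 0) in let y := A (inord 0) (inord 1) in
  let z := A (inord 1) (inord 0) in let w := A (inord 1) (inord 1) in
  \matrix_(i < 3, j < 3) [:: [:: x ^+ 2; x * y; y ^+ 2]`_j;
    [:: 2 * x * z; x * w + y * z; 2 * y * w]`_j; [:: z ^+ 2; z * w; w ^+ 2]`_j]`_i.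

Lemma det_sym_square A : \det (sym_square A) = \det A ^+ 3.
Proof.
rewrite /sym_square.
set x := A (inord 0) (inord 0); set y := A (inord 0) (inord 1).
set z := A (inord 1) (inord 0); set w := A (inord 1) (inord 1).
pose f (i j : nat) :=  [:: [:: x ^+ 2; x * y; y ^+ 2]`_j;
    [:: 2 * x * z; x * w + y * z; 2 * y * w]`_j; [:: z ^+ 2; z * w; w ^+ 2]`_j]`_i.
by rewrite (det_laplace 3 f) /f /bump /= det_mx2 -/x -/y -/z -/w; ring.
Qed.

Lemma catalecticant_push A s : catalecticant (push A s) =
  (sym_square A)^T *m catalecticant s *m sym_square A.
Proof.
apply/matrixP; do 2![apply: ord3_ind].
all: rewrite mxE pushE tens_push !inordK //= !sum2 !(mxE, sum3) !inordK //=.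
all: rewrite /tens !inordK //= ?(addn0, add0n, addnS).
all: ring.
Qed.

Lemma i3_push A s : i3 (push A s) = \det A ^+ 6 * i3 s.
Proof.
rewrite -!det_catalecticant catalecticant_push !det_mulmx det_tr det_sym_square.
ring.
Qed.

Lemma disc_push A s : disc (push A s) = \det A ^+ 12 * disc s.
Proof. rewrite !discE i2_push i3_push; ring. Qed.

(** The length is left free: rows of length 4 are coordinates on gl(V), rows of length 5 are
    coefficients along [orbit_frame], whose last entry, along the Hessian, is dropped here. *)
Definition mx_of_row n (x : 'rV[R]_n.+1) : 'M[R]_2 :=
  \matrix_(i < 2, j < 2) a x (2 * i + j).

Definition row_of_mx n B : 'rV[R]_n.+1 := \row_(m < n.+1)
  [:: B (inord 0) (inord 0); B (inord 0) (inord 1); B (inord 1) (inord 0);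
      B (inord 1) (inord 1)]`_m.

Lemma row_of_mxK n B : (2 < n)%N -> mx_of_row (row_of_mx n B) = B.
Proof.
move=> n2; apply/matrixP => i j; rewrite !mxE.
have n1 := ltnW n2; have n0 := ltnW n1.
by case: (ord2P i) => ->; case: (ord2P j) => ->; rewrite !inordK // !inordK.
Qed.

Lemma mul_orbit_frame x s :
  x *m orbit_frame s = gl_act (mx_of_row x) s + a x 4 *: hess s.
Proof.
apply/rowP => j; rewrite [RHS]mxE gl_actE !mxE sum5 !mxE !inordK //= ?(addn0, add0n,
  addnS, muln0, muln1).
ring.
Qed.

Lemma orbit_frame_unit s : disc s != 0 -> orbit_frame s \in unitmx.
Proof.
by move=> ds; rewrite unitmxE unitfE det_orbit_frame mulf_neq0 ?invr_neq0 ?pnatr_eq0.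
Qed.

(** Given by a formula rather than by choosing a preimage: it is linear in v and, where the frame is
    invertible, rational in s. Smoothness of the Christoffel matrices comes from this. *)
Definition gl_solve s v : 'M[R]_2 := mx_of_row (v *m invmx (orbit_frame s)).

Lemma gl_solveK s v : disc s != 0 -> conormal s v = 0 -> gl_act (gl_solve s v) s = v.
Proof.
move=> ds; set x := v *m invmx (orbit_frame s).
have vE : v = gl_act (mx_of_row x) s + a x 4 *: hess s.
  by rewrite -mul_orbit_frame mulmxKV ?orbit_frame_unit.
(* [conormal] kills the part tangent to the orbit and not the Hessian, so the last coordinate of v
   vanishes. *)
rewrite {1}vE conormalD conormal_gl_act conormalZ conormal_hess add0r => /eqP.
rewrite mulf_eq0 => /orP[/eqP x4|]; first by rewrite [RHS]vE x4 scale0r addr0.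
by rewrite mulf_eq0 oppr_eq0 (negPf ds) invr_eq0 pnatr_eq0.
Qed.

Lemma gl_act_solve s B : disc s != 0 -> gl_solve s (gl_act B s) = B.
Proof.
move=> ds; have e : row_of_mx 4 B *m orbit_frame s = gl_act B s.
  by rewrite mul_orbit_frame row_of_mxK //  mxE !inordK //= scale0r addr0.
by rewrite /gl_solve -e mulmxK ?orbit_frame_unit // row_of_mxK // .
Qed.

Lemma gl_act_inj s B C : disc s != 0 -> gl_act B s = gl_act C s -> B = C.
Proof. by move=> ds e; rewrite -(gl_act_solve B ds) e gl_act_solve. Qed.

Lemma gl_solveD s v v' : gl_solve s (v + v') = gl_solve s v + gl_solve s v'.
Proof. by apply/matrixP => i j; rewrite /gl_solve mulmxDl !mxE. Qed.

Lemma gl_solveZ s c v : gl_solve s (c *: v) = c *: gl_solve s v.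
Proof. by apply/matrixP => i j; rewrite /gl_solve -scalemxAl !mxE. Qed.

Lemma disc0 s : disc s != 0 -> (i3 s != 0) || (i2 s != 0).
Proof.
apply: contraR; rewrite negb_or !negbK => /andP[/eqP e3 /eqP e2].
by rewrite discE e2 e3 !expr0n /= mulr0 subrr mulr0.
Qed.

Lemma GL_orbit_refl s : GL_orbit s s.
Proof. by exists 1%:M; rewrite ?unitmx1 // push1. Qed.

Lemma GL_orbit_push s t A : A \in unitmx -> GL_orbit s (push A t) <-> GL_orbit s t.
Proof.
move=> uA; split=> -[B uB e].
  exists (B *m invmx A); rewrite ?unitmx_mul ?uB ?unitmx_inv // pushM -e -pushM.
  by rewrite mulmxV // push1.
by exists (B *m A); rewrite ?unitmx_mul ?uB // pushM e.
Qed.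

Lemma eq_GL_orbit s t : GL_orbit s t -> GL_orbit t = GL_orbit s.
Proof.
move=> [A uA ->]; apply/seteqP; split=> u [B uB ->];
  first by rewrite !GL_orbit_push //; exact: GL_orbit_refl.
exists (invmx A *m B); first by rewrite unitmx_mul unitmx_inv uA.
by rewrite -pushM mulmxA mulmxV // mul1mx.
Qed.

Lemma disc_orbit s t : disc s != 0 -> GL_orbit s t -> disc t != 0.
Proof.
move=> ds [A uA ->]; rewrite disc_push mulf_neq0 // expf_neq0 //.
by rewrite -unitfE -unitmxE.
Qed.
End Orbit.

(** * Invariants and orbits *)

Section PointwiseDerive.
Variables (R : realType) (V : normedModType R) (x v : V).
Implicit Types (f g : V -> R^o) (a b : R^o).

Lemma is_derive_add f g a b : is_derive x v f a -> is_derive x v g b ->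
  is_derive x v (fun y => f y + g y) (a + b).
Proof. exact: is_deriveD. Qed.

Lemma is_derive_sub f g a b : is_derive x v f a -> is_derive x v g b ->
  is_derive x v (fun y => f y - g y) (a - b).
Proof. exact: is_deriveB. Qed.

Lemma is_derive_mul f g a b : is_derive x v f a -> is_derive x v g b ->
  is_derive x v (fun y => f y * g y : R^o) (f x * b + g x * a).
Proof. exact: is_deriveM. Qed.

Lemma is_derive_exp f n a : is_derive x v f a ->
  is_derive x v (fun y => f y ^+ n : R^o) (n%:R * f x ^+ n.-1 * a).
Proof.
move=> df; have := is_deriveX n df.
by congr is_derive; apply/funext => y; rewrite fctE.
Qed.

Lemma is_derive_const a : is_derive x v (fun=> a : R^o) 0.
Proof. exact: is_derive_cst. Qed.

Lemma is_derive_sum_ord n (f : 'I_n -> V -> R^o) (a : 'I_n -> R^o) :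
  (forall i, is_derive x v (f i) (a i)) ->
  is_derive x v (fun y => \sum_i f i y) (\sum_i a i).
Proof.
move=> df; have := is_derive_sum df.
by congr is_derive; apply/funext => y; rewrite fct_sumE.
Qed.

Lemma differentiable_is_derive (W : normedModType R) (f : V -> W) :
  differentiable f x -> is_derive x v f ('D_v f x).
Proof. by move=> df; apply/derivableP/diff_derivable. Qed.

Lemma is_derive_mx_entry m n (f : V -> 'M[R]_(m.+1, n.+1)) i j :
  differentiable f x -> is_derive x v ((fun y => f y i j) : V -> R^o) (('D_v f x) i j).
Proof.
by move=> df; rewrite derive_entry //; apply: differentiable_is_derive;
  exact: differentiable_entry.
Qed.

Lemma derive_mulmx m n p (F : V -> 'M[R]_(m.+1, n.+1)) (G : V -> 'M[R]_(n.+1, p.+1)) :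
  differentiable F x -> differentiable G x ->
  differentiable (fun y => F y *m G y) x /\
  'D_v (fun y => F y *m G y) x = 'D_v F x *m G x + F x *m 'D_v G x.
Proof.
move=> dF dG.
have dFG : differentiable (fun y => F y *m G y) x.
  apply: differentiable_mx => i j; under eq_fun do rewrite mxE.
  rewrite (_ : (fun _ => _) = \sum_l ((fun y => F y i l) * (fun y => G y l j) : V ->
    R^o)); last first.
    by apply/funext => y; rewrite fct_sumE.
  by apply: differentiable_sum => l; apply: differentiableM;
    exact: differentiable_entry.
split=> //; apply/matrixP => i j; rewrite derive_entry // !mxE -big_split /=.
under [in LHS]eq_fun do rewrite mxE.
have := is_derive_sum_ord (fun l => is_derive_mul (is_derive_mx_entry i l dF)
  (is_derive_mx_entry l j dG)).
move=> [_ ->]; apply: eq_bigr => l _; ring.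
Qed.

Lemma derive_push (F : V -> 'M[R]_2) (S : V -> S4 R) :
  differentiable F x -> differentiable S x ->
  is_derive x v (fun y => push (F y) (S y))
    (push (F x) ('D_v S x) + dpush (F x) ('D_v F x) (S x)).
Proof.
move=> dF dS.
have dpE m : is_derive x v ((fun y => push (F y) (S y) 0 m) : V -> R^o)
    ((push (F x) ('D_v S x) + dpush (F x) ('D_v F x) (S x)) 0 m).
  rewrite mxE /push /dpush /untens; under eq_fun do rewrite mxE.
  rewrite !mxE; apply: is_derive_eq.
    do 4![apply: is_derive_sum_ord => ?].
    do 4![apply: is_derive_mul; last exact: is_derive_mx_entry].
    exact: is_derive_mx_entry.
  by do 4![rewrite -big_split; apply: eq_bigr => ? _ /=]; rewrite /tens; ring.
have dp : derivable (fun y => push (F y) (S y)) x v.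
  by apply/derivable_mxP => i j; rewrite ord1; have [] := dpE j.
split=> //; apply/matrixP => i m; rewrite derive_mx // mxE ord1.
by have [_ ->] := dpE m.
Qed.

End PointwiseDerive.

Ltac smooth_poly := repeat first [exact: smooth_cst | exact: smooth_coord
  | apply: smoothX | apply: smoothM | apply: smoothB | apply: smoothD | done].

(** * Absolute invariants whose differential is a multiple of the conormal *)

Section Invariants.
Variable R : realType.
Implicit Types (s t v : S4 R) (A : 'M[R]_2) (U W : set (S4 R)).
Local Notation a s k := (s 0 (inord k)).

Lemma smooth_i2 U : open U -> smooth U (@i2 R : S4 R -> R^o).
Proof. by move=> oU; rewrite /i2; smooth_poly. Qed.

Lemma smooth_i3 U : open U -> smooth U (@i3 R : S4 R -> R^o).
Proof. by move=> oU; rewrite /i3; smooth_poly. Qed.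

Lemma is_derive_coord n (x v : 'rV[R]_n.+1) k :
  is_derive x v ((fun y : 'rV[R]_n.+1 => y 0 k) : _ -> R^o) (v 0 k).
Proof.
rewrite -(is_derive_entry k v x); apply: differentiable_is_derive.
exact: (@differentiable_coord R 1 n.+1 x 0 k).
Qed.

Ltac derive_poly :=
  apply: is_derive_eq;
  [repeat first [apply: is_derive_coord | apply: is_derive_const
    | apply: is_derive_sub | apply: is_derive_add | apply: is_derive_mul
    | apply: is_derive_exp] | rewrite /=].

Lemma is_derive_i2 s v : is_derive s v (@i2 R : S4 R -> R^o) (di2 s v).
Proof. rewrite /i2; derive_poly; rewrite /di2; ring. Qed.

Lemma is_derive_i3 s v : is_derive s v (@i3 R : S4 R -> R^o) (di3 s v).
Proof. rewrite /i3; derive_poly; rewrite /di3; ring. Qed.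

(* f has weight 2p, h has weight 2q and r = p / 2q, so f * (h^2)^(-r) is an
   absolute invariant. *)
Section WeightedInvariant.
Variables (f h : S4 R -> R^o) (df dh : S4 R -> S4 R -> R) (p q : nat) (r : R).
Hypotheses (sf : forall U, open U -> smooth U f) (sh : forall U, open U -> smooth U h).
Hypotheses (fE : forall s v, is_derive s v f (df s v)).
Hypotheses (hE : forall s v, is_derive s v h (dh s v)).
Hypotheses (f_push : forall A s, f (push A s) = \det A ^+ (2 * p) * f s).
Hypotheses (h_push : forall A s, h (push A s) = \det A ^+ (2 * q) * h s).
Hypothesis weights : 2 * q%:R * r = p%:R.

Let I s : R^o := f s * (h s ^+ 2) `^ (- r).

Lemma weighted_invariant_push A s : A \in unitmx -> I (push A s) = I s.
Proof.
rewrite unitmxE unitfE => uA; rewrite /I f_push h_push exprMn.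
set d := \det A; have d0 : 0 < d ^+ 2 by rewrite exprn_even_gt0.
(* The base d^2 is positive even if the determinant is negative, so the rules for real exponents
   apply. *)
have -> : (d ^+ (2 * q)) ^+ 2 = (d ^+ 2) `^ (2 * q)%:R.
  by rewrite powR_mulrn ?ltW // -!exprM mulnC.
rewrite powRM ?sqr_ge0 ?powR_ge0 // -powRrM mulrN natrM weights [_ `^ (- p%:R)]powRN.
rewrite powR_mulrn ?ltW // -exprM.
rewrite mulrACA mulfV ?mul1r // expf_neq0 //; exact: lt0r_neq0.
Qed.

Lemma smooth_weighted_invariant U : open U -> (forall s, U s -> h s != 0) -> smooth U I.
Proof.
move=> oU h0; apply: smoothM => //; first exact: sf.
apply: smooth_powR => //; last by apply: smoothX => //; exact: sh.
by move=> s /h0 hs; rewrite exprn_even_gt0.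
Qed.

Lemma derive_weighted_invariant s v : h s != 0 -> 'D_v I s =
  (h s ^+ 2) `^ (- r - 1) * h s * (h s * df s v - 2 * r * f s * dh s v).
Proof.
move=> hs; have h2 : 0 < h s ^+ 2 by rewrite exprn_even_gt0.
pose k (y : S4 R) : R^o := h y ^+ 2.
have dk : is_derive s v k (2 * h s * dh s v) by apply: is_derive_eq (is_derive_exp 2
  (hE s v)) _.
have dfk : differentiable k s.
  by apply: (@smooth_differentiable _ _ setT) => //; apply: smoothX (sh _);
    exact: openT.
have dp : is_derive s v (fun y => k y `^ (- r) : R^o) (- r * k s `^ (- r - 1) * (2 * h
  s * dh s v)).
  exact: (is_derive_comp1 dfk dk (is_derive1_powR (- r) h2)).
have [_ ->] := is_derive_mul (fE s v) dp.
rewrite /k; have -> : (h s ^+ 2) `^ (- r) = (h s ^+ 2) `^ (- r - 1) * h s ^+ 2.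
  rewrite -[X in _ = _ * X]powRr1 ?sqr_ge0 // -powRD ?subrK //.
  by apply/implyP => _; exact: lt0r_neq0.
ring.
Qed.

End WeightedInvariant.

(** The denominator is [i3] if it is nonzero at [s0], and [i2] otherwise; the exponents 1/3 and 3/4
    balance the weights. The set [W] is stable under [push], so that neighbourhoods can later be
    saturated inside it. *)
Lemma conormal_invariant s0 : disc s0 != 0 ->
  exists (W : set (S4 R)) (I : S4 R -> R^o) (g : S4 R -> R),
  [/\ open W, W s0, forall A s, A \in unitmx -> W s -> W (push A s)
    & forall s, W s -> disc s != 0] /\
  [/\ smooth W I, forall A s, A \in unitmx -> I (push A s) = I s,
      forall s, W s -> g s != 0
    & forall s v, W s -> 'D_v I s = g s * conormal s v].
Proof.
move=> ds0.
have oN (k : S4 R -> R^o) : smooth setT k -> open [set s | k s != 0].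
  move=> sk; apply: (@open_comp _ _ k [set t | t != 0]); last exact: open_neq.
  by move=> s _; exact: (smooth_continuous sk).
have sdisc : smooth setT (@disc R : S4 R -> R^o).
  have oT := @openT (S4 R).
  apply: (@eq_smooth _ _ _ oT _ (fun s => 256 * (i2 s ^+ 3 - 27 * i3 s ^+ 2))) => //.
  by repeat first [exact: smooth_cst | exact: smooth_i2 | exact: smooth_i3
    | apply: smoothX | apply: smoothM | apply: smoothB | done].
have mem (k : S4 R -> R^o) n : smooth setT k ->
    (forall A s, k (push A s) = \det A ^+ n * k s) -> k s0 != 0 ->
    let W := [set s | disc s != 0] `&` [set s | k s != 0] in
    [/\ open W, W s0, forall A s, A \in unitmx -> W s -> W (push A s)
    & forall s, W s -> disc s != 0].
  move=> sk kE k0 W; split=> [||A s uA [ds ks]|s []] //.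
    by apply: openI; exact: oN.
  have dA : \det A != 0 by rewrite -unitfE -unitmxE.
  by split; rewrite /= ?disc_push ?kE mulf_neq0 ?expf_neq0.
have [h0|/= h0] := orP (disc0 ds0).
  have W0 := mem (@i3 R) 6%N (smooth_i3 openT) (@i3_push R) h0; move: W0 => /=.
  set W := _ `&` _ => W0; have [oW _ _ _] := W0.
  exists W, (fun s => i2 s * (i3 s ^+ 2) `^ (- (1 / 3))),
    (fun s => (i3 s ^+ 2) `^ (- (1 / 3) - 1) * i3 s / 3); split=> //; split.
  - by apply: smooth_weighted_invariant => // [U|U|s []//];
    [exact: smooth_i2|exact: smooth_i3].
  - move=> A s; apply: (@weighted_invariant_push _ _ 2 3) => //;
    [exact: i2_push|exact: i3_push|by field].
  - move=> s [_ /= hs]; rewrite !mulf_neq0 ?invr_neq0 ?pnatr_eq0 //.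
    by rewrite powR_eq0 sqrf_eq0 (negPf hs).
  - move=> s v [_ /= hs].
    rewrite (derive_weighted_invariant _ smooth_i3 is_derive_i2 is_derive_i3) //
      /conormal; by field.
have W0 := mem (@i2 R) 4%N (smooth_i2 openT) (@i2_push R) h0; move: W0 => /=.
set W := _ `&` _ => W0; have [oW _ _ _] := W0.
exists W, (fun s => i3 s * (i2 s ^+ 2) `^ (- (3 / 4))),
  (fun s => - (i2 s ^+ 2) `^ (- (3 / 4) - 1) * i2 s / 2); split=> //; split.
- by apply: smooth_weighted_invariant => // [U|U|s []//];
  [exact: smooth_i3|exact: smooth_i2].
- move=> A s; apply: (@weighted_invariant_push _ _ 3 2) => //;
  [exact: i3_push|exact: i2_push|by field].
- move=> s [_ /= hs]; rewrite !mulf_neq0 ?oppr_eq0 ?invr_neq0 ?pnatr_eq0 //.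
  by rewrite powR_eq0 sqrf_eq0 (negPf hs).
- move=> s v [_ /= hs].
  rewrite (derive_weighted_invariant _ smooth_i2 is_derive_i3 is_derive_i2) //
    /conormal; by field.
Qed.
End Invariants.

(** * Calculus along line segments *)

Section Line.
Variables (R : realType) (V : normedModType R).

Lemma is_derive_line (W : normedModType R) (f : V -> W) (x w : V) (t : R) (l : W) :
  is_derive (x + t *: w) w f l ->
  is_derive t 1 ((fun r : R^o => f (x + r *: w)) : R^o -> W) l.
Proof.
have e : (fun h : R => h^-1 *: (((fun r : R^o => f (x + r *: w)) \o shift t) (h *: (1 :
  R^o))
       - f (x + t *: w))) =
    (fun h : R => h^-1 *: ((f \o shift (x + t *: w)) (h *: w) - f (x + t *: w))).
  apply/funext => h /=; congr (_ *: (f _ - _)).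
  by rewrite [_ *: 1]mulr1 scalerDl addrCA.
by move=> [dfl <-]; split; rewrite /derivable /derive /= e.
Qed.

Lemma MVT_line (f : V -> R^o) (x y : V) :
  (forall t : R, 0 <= t <= 1 -> differentiable f (x + t *: (y - x))) ->
  exists2 t : R, 0 <= t <= 1 & f y - f x = 'D_(y - x) f (x + t *: (y - x)).
Proof.
move=> df; pose phi (r : R^o) : R^o := f (x + r *: (y - x)).
have dphi t : 0 <= t <= 1 -> is_derive (t : R^o) 1 phi ('D_(y - x) f (x + t *: (y -
  x))).
  by move=> t01; apply: is_derive_line; apply: differentiable_is_derive; exact: df.
have [||t] := @MVT R phi (fun t => 'D_(y - x) f (x + t *: (y - x))) 0 1 ltr01.
- by move=> t /itvP tP; apply: dphi; rewrite !tP.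
- apply: derivable_within_continuous => t; rewrite in_itv /= => t01.
  by have [] := dphi t t01.
move=> /itvP tP; rewrite /phi scale1r scale0r addr0 subrKC subr0 mulr1 => e.
by exists t; rewrite ?tP.
Qed.

Lemma derive_local_min (f : V -> R^o) (x w : V) : (forall y, differentiable f y) ->
  (\forall y \near x, f x <= f y) -> 'D_w f x = 0.
Proof.
move=> df fmin; pose phi (r : R^o) : R^o := f (x + r *: w).
have dphi t : is_derive (t : R^o) 1 phi ('D_w f (x + t *: w)).
  by apply: is_derive_line; exact: differentiable_is_derive.
have : \forall r \near (0 : R^o), phi 0 <= phi r.
  have cw : (x + r *: w) @[r --> (0 : R^o)] --> x.
    rewrite -[X in _ --> X]addr0 -(scale0r w).
    by apply: cvgD; [exact: cvg_cst|exact: scalel_continuous].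
  have := cw _ fmin; rewrite /phi scale0r addr0; exact.
move=> /nbhs_ballP[e /= e0 he].
have phi_min t : t \in `](- e), e[%R -> phi 0 <= phi t.
  rewrite in_itv /= => te; apply: he.
  by rewrite -ball_normE /= sub0r normrN ltr_norml.
have e_itv : 0 \in `](- e), e[%R by rewrite in_itv /= e0 oppr_lt0 e0.
have d0 : is_derive (0 : R) (1 : R) phi 0.
  by apply: (@derive1_at_min R phi (- e) e) => //; rewrite ge0_cp // ltW.
by have [_] := d0; have [_ ->] := dphi 0; rewrite scale0r addr0.
Qed.
End Line.

(** * Normals to the orbits *)

Section Slice.
Variable R : realType.
Implicit Types (s t u v : S4 R) (A B : 'M[R]_2).

(** An auxiliary Euclidean product, with no invariance under [push]. The norm of row vectors is the
    maximum norm, which is not differentiable, so distances are minimised through [dot]; comparing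
    the two costs a factor 5, the number of components. *)
Definition dot s v : R := \sum_j s 0 j * v 0 j.

Definition covector s : S4 R := \row_j conormal s (delta_mx 0 j).

Lemma conormal_dot s v : conormal s v = dot (covector s) v.
Proof.
rewrite {1}(row_sum_delta v) /dot.
have : forall r : seq 'I_5, conormal s (\sum_(j <- r) v 0 j *: delta_mx 0 j)
    = \sum_(j <- r) covector s 0 j * v 0 j; last by [].
elim=> [|j r IH]; first by rewrite !big_nil -(scale0r 0) conormalZ mul0r.
by rewrite !big_cons conormalD conormalZ IH [covector s 0 j]mxE mulrC.
Qed.

Lemma dotC s v : dot s v = dot v s.
Proof. by apply: eq_bigr => j _; rewrite mulrC. Qed.

Lemma dotDl s t v : dot (s + t) v = dot s v + dot t v.
Proof. by rewrite -big_split; apply: eq_bigr => j _; rewrite mxE mulrDl. Qed.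

Lemma dotZl c s v : dot (c *: s) v = c * dot s v.
Proof. by rewrite mulr_sumr; apply: eq_bigr => j _; rewrite mxE mulrA. Qed.

Lemma dot_eq0 s : (dot s s == 0) = (s == 0).
Proof.
apply/eqP/eqP => [/eqP|->]; last by rewrite /dot big1 // => j _; rewrite mxE mul0r.
rewrite psumr_eq0 => [/allP s0|j _]; last by rewrite -expr2 sqr_ge0.
apply/rowP => j; have := s0 j (mem_index_enum j).
by rewrite mulf_eq0 orbb mxE => /eqP.
Qed.

Lemma dot_ge0 s : 0 <= dot s s.
Proof. by apply: sumr_ge0 => j _; rewrite -expr2 sqr_ge0. Qed.

Lemma entry_le_norm n (x : 'rV[R]_n.+1) j : `|x 0 j| <= `|x|.
Proof.
by rewrite [leRHS]mx_normrE (le_bigmax _ (fun ij => `|x ij.1 ij.2|) (0, j)).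
Qed.

Lemma dot_le_norm s : dot s s <= 5 * `|s| ^+ 2.
Proof.
have le j : s 0 j * s 0 j <= `|s| ^+ 2.
  by rewrite -expr2 -real_normK ?num_real // ler_pXn2r ?nnegrE // entry_le_norm.
apply: le_trans (ler_sum _ (fun j _ => le j)) _.
by rewrite sumr_const card_ord mulr_natl.
Qed.

Lemma norm_le_dot s : `|s| ^+ 2 <= dot s s.
Proof.
have [->|s0] := eqVneq s 0; first by rewrite normr0 expr0n /= dot_ge0.
have [[i j] /= sj] : exists i, mx_norm s = `|s i.1 i.2|.
  by apply: mx_norm_neq0; rewrite -[mx_norm s]/`|s| normr_eq0.
rewrite [`|s|]sj real_normK ?num_real // ord1 /dot (bigD1 j) //= -expr2 lerDl.
by apply: sumr_ge0 => l _; rewrite -expr2 sqr_ge0.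
Qed.

Lemma covector_neq0 s : disc s != 0 -> covector s != 0.
Proof.
move=> ds; apply/eqP => c0.
have /eqP := conormal_hess s; rewrite conormal_dot c0 /dot big1; last by move=> j _;
  rewrite mxE mul0r.
by rewrite eq_sym mulf_eq0 oppr_eq0 (negPf ds) invr_eq0 pnatr_eq0.
Qed.

Lemma covector_gt0 s : disc s != 0 -> 0 < dot (covector s) (covector s).
Proof.
by move=> /covector_neq0 c0; rewrite lt_neqAle dot_ge0 andbT eq_sym dot_eq0.
Qed.

(** Once its projection on the covector is removed, r is killed by [conormal], hence tangent to the
    orbit; being also normal to it, the remainder is orthogonal to itself. *)
Lemma normal_covector u r : disc u != 0 -> (forall B, dot r (gl_act B u) = 0) ->
  exists c, r = c *: covector u.
Proof.
move=> du rB; have c0 := covector_gt0 du.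
pose c := dot r (covector u) / dot (covector u) (covector u); exists c.
pose r' := r + (- c) *: covector u.
have r'c : dot r' (covector u) = 0.
  by rewrite dotDl dotZl mulNr divfK ?subrr // lt0r_neq0.
have r'E : gl_act (gl_solve u r') u = r'.
  by apply: gl_solveK => //; rewrite conormal_dot dotC.
have : dot r' r' == 0.
  rewrite {1}/r' dotDl dotZl [dot (covector u) _]dotC r'c mulr0 addr0.
  by rewrite -r'E rB.
by rewrite dot_eq0 /r' scaleNr subr_eq0 => /eqP.
Qed.
End Slice.

(** * Level sets and orbits near a point *)

Section OrbitChart.
Variable R : realType.
Implicit Types (s t u v : S4 R) (A B : 'M[R]_2) (z : 'rV[R]_4).

Lemma mx_of_rowK z : row_of_mx 3 (mx_of_row z) = z.
Proof.
apply/rowP => m; rewrite !mxE !inordK //.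
by rewrite -[in RHS](inord_val m); case: m => [[|[|[|[|]]]]].
Qed.

(** The affine coordinates 1 + Z of GL(V) near the identity, rather than an exponential, keep this
    map polynomial. *)
Definition orbit_chart s z : S4 R := push (1%:M + mx_of_row z) s.

Lemma differentiable_affine z :
  differentiable (fun y => 1%:M + mx_of_row y) z.
Proof.
apply: differentiable_mx => i j; under eq_fun do rewrite !mxE.
apply: (@smooth_differentiable _ _ setT) => //.
by apply: smoothD; [exact: openT|exact: smooth_cst|exact: smooth_coord].
Qed.

Lemma derive_affine z w :
  'D_w (fun y => 1%:M + mx_of_row y) z = mx_of_row w.
Proof.
apply/matrixP => i j; rewrite derive_entry; last exact: differentiable_affine.
rewrite mxE; under eq_fun do rewrite !mxE.
have [_ ->] := is_derive_add (is_derive_const z w (i == j)%:R)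
  (is_derive_coord z w (inord (2 * i + j))).
by rewrite add0r.
Qed.

Lemma derive_orbit_chart s z w : is_derive z w (orbit_chart s)
  (dpush (1%:M + mx_of_row z) (mx_of_row w) s).
Proof.
apply: is_derive_eq; first by apply: (derive_push w (differentiable_affine z));
  exact: differentiable_cst.
rewrite derive_affine derive_cst.
by rewrite -(scale0r s) pushZ scale0r add0r.
Qed.

Lemma smooth_orbit_chart s : smooth setT (orbit_chart s).
Proof.
have oT := @openT 'rV[R]_4.
apply: smooth_mx => // i j; rewrite ord1 /orbit_chart.
under eq_fun do rewrite mxE.
do 4![apply: smooth_sum => // ?]; repeat apply: smoothM => //; first exact: smooth_cst.
all: by under eq_fun do rewrite !mxE; apply: smoothD => //;
  [exact: smooth_cst|exact: smooth_coord].
Qed.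

Lemma continuous_orbit_chart s : continuous (orbit_chart s).
Proof. by move=> z; exact: (smooth_continuous (@smooth_orbit_chart s)). Qed.

Lemma orbit_chart0 s : orbit_chart s 0 = s.
Proof.
rewrite /orbit_chart (_ : mx_of_row 0 = 0) ?addr0 ?push1 //.
by apply/matrixP => i j; rewrite !mxE.
Qed.

Lemma near_affine_unit : \forall z \near (0 : 'rV[R]_4), 1%:M + mx_of_row z \in unitmx.
Proof.
have cdet : {for (0 : 'rV[R]_4), continuous (fun z => \det (1%:M + mx_of_row z) : R^o)}.
  apply: (@smooth_continuous _ _ setT) => //; apply: smooth_det; first exact: openT.
  move=> i j; under eq_fun do rewrite !mxE.
  by apply: smoothD; [exact: openT|exact: smooth_cst|exact: smooth_coord].
have /cdet : nbhs (\det (1%:M + mx_of_row (0 : 'rV[R]_4)) : R^o) [set t | t != 0].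
  apply: open_nbhs_nbhs; split; first exact: open_neq.
  rewrite /= (_ : mx_of_row 0 = 0) ?addr0 ?det1 ?oner_neq0 //.
  by apply/matrixP => i j; rewrite !mxE.
move=> H; have : \forall z \near (0 : 'rV[R]_4), \det (1%:M + mx_of_row z) != 0 := H.
by apply: filterS => z; rewrite unitmxE unitfE.
Qed.

(** [gl_solve s] is a linear left inverse of the infinitesimal action; c is the inverse of a
    Lipschitz constant of it. *)
Lemma gl_act_lower_bound s : disc s != 0 ->
  exists2 c : R, 0 < c & forall z, c * `|z| <= `|gl_act (mx_of_row z) s|.
Proof.
move=> ds; pose G (v : S4 R) : 'rV[R]_4 := row_of_mx 3 (gl_solve s v).
have lG : linear G.
  move=> c u v; rewrite /G gl_solveD gl_solveZ; apply/rowP;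
    case=> [[|[|[|[|]]]]] //= lt4; by rewrite !mxE /= ?mxE.
pose lM := GRing.isLinear.Build _ _ _ _ _ lG.
pose L : {linear S4 R -> 'rV[R]_4} := HB.pack G lM.
have cL : continuous L.
  have sG : smooth setT (G : S4 R -> 'rV[R]_4).
    have sE a b : smooth setT ((fun v : S4 R => gl_solve s v a b) : S4 R -> R^o).
      under eq_fun do rewrite !mxE.
      apply: (smooth_sum (@openT _)) => l; apply: (smoothM (@openT _));
        first exact: smooth_coord.
      exact: smooth_cst.
    apply: (smooth_mx (@openT _)) => i m; under eq_fun do rewrite mxE.
    by case: m => [[|[|[|[|]]]]] //= _; exact: sE.
  by move=> v; exact: (smooth_continuous sG).
have [k k0 hk] := linear_lipschitz cL.
exists k^-1; first by rewrite invr_gt0.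
move=> z; rewrite ler_pdivrMl //; apply: le_trans (hk _).
by rewrite /L /= /G gl_act_solve // mx_of_rowK.
Qed.

(** Half of the lower bound for the differential at 0 absorbs the remainder of the first order
    expansion. The estimate keeps the images of small spheres away from s, which forces minimisers
    into the interior. *)
Lemma orbit_chart_proper s : disc s != 0 -> exists2 c : R, 0 < c &
  \forall z \near (0 : 'rV[R]_4), c * `|z| <= `|orbit_chart s z - s|.
Proof.
move=> /gl_act_lower_bound[c c0 hc]; exists (c / 2); first by rewrite divr_gt0.
have df : differentiable (orbit_chart s) 0.
  by apply: (@smooth_differentiable _ _ setT) => //; exact: smooth_orbit_chart.
have := diff_locally df; move/eqaddoP => /(_ (c / 2)); rewrite divr_gt0 // => /(_ isT).
apply: filterS => z; rewrite !fctE /= addr0 orbit_chart0.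
have -> : 'd (orbit_chart s) 0 z = gl_act (mx_of_row z) s.
  rewrite -deriveE //; have [_ ->] := derive_orbit_chart s 0 z.
  rewrite (_ : mx_of_row 0 = 0); last by apply/matrixP => i j; rewrite !mxE.
  by rewrite addr0 -[mx_of_row z in LHS]mul1mx -gl_act_push push1.
have := hc z; set u := gl_act _ _ => hz.
rewrite opprD addrA => h.
have : `|u| <= `|orbit_chart s z - s| + `|orbit_chart s z - s - u|.
  by rewrite -{1}(subKr (orbit_chart s z - s) u) (le_trans (ler_normB _ _)).
move: h; set x := `|_ - _ - _|; lra.
Qed.

Lemma smooth_covector j : smooth setT ((fun s : S4 R => covector s 0 j) : S4 R -> R^o).
Proof.
have oT := @openT (S4 R).
under eq_fun do rewrite mxE /conormal.
apply: smoothB => //; apply: smoothM => //.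
- by apply: smoothM => //; [exact: smooth_cst|exact: smooth_i3].
- by rewrite /di2; smooth_poly.
- by apply: smoothM => //; [exact: smooth_cst|exact: smooth_i2].
- by rewrite /di3; smooth_poly.
Qed.

(** A displacement along [covector u] is thus transverse to the orbit through every nearby x, and
    not only at u; the mean value theorem gives no control on which x occurs. *)
Lemma near_covector s : disc s != 0 -> exists2 e : R, 0 < e &
  forall u x, ball s e u -> ball s e x -> 0 < dot (covector u) (covector x).
Proof.
move=> ds.
pose F (p : S4 R * S4 R) : R := dot (covector p.1) (covector p.2).
have cF : {for (s, s), continuous F}.
  rewrite /F /dot; apply: cvg_big => [|j _]; first exact: add_continuous.
  apply: cvgM.
    apply: (@continuous_comp _ _ _ fst (fun u : S4 R => covector u 0 j));
      first exact: cvg_fst.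
    exact: (smooth_continuous (smooth_covector j)).
  apply: (@continuous_comp _ _ _ snd (fun u : S4 R => covector u 0 j));
    first exact: cvg_snd.
  exact: (smooth_continuous (smooth_covector j)).
have /cF : nbhs (F (s, s)) [set t : R | 0 < t].
  by apply: open_nbhs_nbhs; split; [exact: open_gt|exact: covector_gt0].
move=> /nbhs_ballP[e /= e0 he]; exists e => // u x su sx.
by apply: (he (u, x)); split.
Qed.

(* At a point z minimising the distance from t to orbit_chart s z, the residual
   is normal to the orbit; an invariant whose differential is a nonzero multiple
   of the conormal cannot take the same value at both ends unless it is 0. *)
Lemma orbit_locally_level s (W : set (S4 R)) (I : S4 R -> R^o) (g : S4 R -> R) :
  open W -> W s -> (forall t, W t -> disc t != 0) -> smooth W I ->
  (forall A t, A \in unitmx -> I (push A t) = I t) -> (forall t, W t -> g t != 0) ->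
  (forall t v, W t -> 'D_v I t = g t * conormal t v) ->
  exists2 e : R, 0 < e & forall t, ball s e t -> W t /\ (I t = I s -> GL_orbit s t).
Proof.
move=> oW Ws Wd sI Ipush g0 dI; have ds := Wd s Ws.
have [e1 e10 he1] := near_covector ds.
have /nbhs_ballP[e2 /= e20 he2] : nbhs s W by exact: open_nbhs_nbhs.
pose e := Num.min e1 e2; have e0 : 0 < e by rewrite lt_min e10.
have eW t : ball s e t -> W t by move=> st; apply: he2; apply: le_ball st;
  rewrite ge_min lexx orbT.
have ecov u x : ball s e u -> ball s e x -> 0 < dot (covector u) (covector x).
  by move=> su sx; apply: he1; [apply: le_ball su|apply: le_ball sx];
    rewrite ge_min lexx.
have [c c0 hc] := orbit_chart_proper ds.
have hb : \forall z \near (0 : 'rV[R]_4), ball s e (orbit_chart s z).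
  apply: (@continuous_orbit_chart s 0); rewrite orbit_chart0; exact: nbhsx_ballx.
have /nbhs_ballP[rho0 /= rho00 hrho] : nbhs (0 : 'rV[R]_4)
    ([set z | c * `|z| <= `|orbit_chart s z - s| /\ ball s e (orbit_chart s z)] `&`
     [set z | 1%:M + mx_of_row z \in unitmx]).
  exact: filterI (filterI hc hb) near_affine_unit.
pose rho := rho0 / 2; have rho_gt0 : 0 < rho by rewrite divr_gt0.
have {}hrho z : `|z| <= rho -> [/\ c * `|z| <= `|orbit_chart s z - s|,
    ball s e (orbit_chart s z) & 1%:M + mx_of_row z \in unitmx].
  move=> zr; have [|[]] := hrho z; last by [].
  rewrite -ball_normE /= sub0r normrN (le_lt_trans zr) // /rho.
  by rewrite ltr_pdivrMr // ltr_pMr // ltr1n.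
(* For |z| = rho the chart is at distance at least c rho >= 4 eta from s, hence at least 3 eta from
   t, so the function Q below is at least 9 eta^2 there. As Q 0 <= 5 eta^2, the minimum is not
   reached on the sphere. *)
pose eta := Num.min e (c * rho / 4).
have eta0 : 0 < eta by rewrite lt_min e0 divr_gt0 ?mulr_gt0.
exists eta => // t st.
have {}st : `|s - t| < eta by move: st; rewrite -ball_normE.
have ste : ball s e t by rewrite -ball_normE /= (lt_le_trans st) // ge_min lexx.
split=> [|It]; first exact: eW.
pose Q z : R^o := dot (orbit_chart s z - t) (orbit_chart s z - t).
have subE y j : (orbit_chart s y - t) 0 j = orbit_chart s y 0 j - t 0 j.
  by rewrite mxE [X in _ + X]mxE.
have sQ : smooth setT Q.
  have oT := @openT 'rV[R]_4.
  apply: smooth_sum => // j.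
  have sj : smooth setT ((fun z => (orbit_chart s z - t) 0 j) : 'rV[R]_4 -> R^o).
    under eq_fun do rewrite subE.
    apply: smoothB => //; last exact: smooth_cst.
    exact: (smooth_entry oT 0 j (@smooth_orbit_chart s)).
  exact: smoothM.
have K_compact : compact [set z : 'rV[R]_4 | `|z| <= rho].
  apply: bounded_closed_compact.
    by exists rho; split; [exact: num_real|move=> M rM z /= /le_trans; apply;
      exact: ltW].
  apply: (@closed_comp _ _ (fun z : 'rV[R]_4 => `|z|) [set x | x <= rho]);
    last exact: closed_le.
  by move=> z _; exact: norm_continuous.
have [||z] := EVT_min_rV _ K_compact (f := Q).
- by exists 0; rewrite /= normr0 ltW.
- by apply: continuous_subspaceT => z; exact: (smooth_continuous sQ).
rewrite inE /= => zrho zmin.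
have [czs su uz] := hrho z zrho.
set u := orbit_chart s z in czs su.
have Qst : Q 0 <= 5 * eta ^+ 2.
  rewrite /Q orbit_chart0; apply: le_trans (dot_le_norm _) _.
  by rewrite ler_pM2l //; apply: lerXn2r; rewrite ?nnegrE //; exact: ltW.
have zlt : `|z| < rho.
  rewrite lt_neqAle zrho andbT; apply/eqP => zr.
  have ut : 3 * eta <= `|u - t|.
    have h1 : `|u - s| <= `|u - t| + `|s - t|.
      by rewrite -[X in _ <= _ + X]normrN opprB (le_trans _ (ler_normD _ _)) // addrA
        subrK.
    have h2 : eta <= c * rho / 4 by rewrite ge_min lexx orbT.
    move: czs; rewrite zr; lra.
  have : 9 * eta ^+ 2 <= Q z.
    apply: le_trans (norm_le_dot _); have -> : 9 * eta ^+ 2 = (3 * eta) ^+ 2 by ring.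
    by apply: lerXn2r; rewrite ?nnegrE // mulr_ge0 // ltW.
  have : Q z <= Q 0 by apply: zmin; rewrite inE /= normr0 ltW.
  have : 0 < eta ^+ 2 by rewrite exprn_gt0.
  lra.
have crit w : 'D_w Q z = 0.
  apply: derive_local_min => [y|].
    exact: (smooth_differentiable sQ).
  apply/nbhs_ballP; exists (rho - `|z|); first by rewrite /= subr_gt0.
  move=> y; rewrite -ball_normE /= => zy; apply: zmin; rewrite inE /=.
  have : `|y| <= `|z| + `|z - y| by rewrite -{1}(subKr z y) ler_normB.
  lra.
have normal B : dot (u - t) (gl_act B u) = 0.
  (* In this direction the derivative of the chart at z is [gl_act B u], so criticality of z gives
     orthogonality to every tangent vector of the orbit at u. *)
  pose w := row_of_mx 3 ((1%:M + mx_of_row z) *m B).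
  have wE : gl_act B u = dpush (1%:M + mx_of_row z) (mx_of_row w) s.
    by rewrite row_of_mxK // gl_act_push.
  have dj j : is_derive z w ((fun y => (orbit_chart s y - t) 0 j) : 'rV[R]_4 ->
    R^o) (gl_act B u 0 j).
    have dz := derive_orbit_chart s z w.
    have := is_derive_sub (is_derive_mx_entry w 0 j
      (@smooth_differentiable _ _ setT _ _ z (@smooth_orbit_chart s) Logic.I))
        (is_derive_const z w (t 0 j)).
    rewrite subr0 (@derive_val _ _ _ _ _ _ _ dz) -wE.
    by congr is_derive; apply/funext => y; rewrite subE.
  have := crit w; rewrite /Q /dot.
  have [_ ->] := is_derive_sum_ord (fun j => is_derive_mul (dj j) (dj j)).
  rewrite -/u => e2'.
  have : 2 * dot (u - t) (gl_act B u) = 0.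
    by rewrite -[RHS]e2' /dot mulr_sumr; apply: eq_bigr => j _; ring.
  by move/eqP; rewrite mulf_eq0 pnatr_eq0 => /eqP.
have [k uk] := normal_covector (Wd u (eW u su)) normal.
have seg x : 0 <= x <= 1 -> ball s e (t + x *: (u - t)).
  move: su ste; rewrite -!ball_normE /= => su ste /andP[x0 x1].
  have -> : s - (t + x *: (u - t)) = (1 - x) *: (s - t) + x *: (s - u).
    by apply/rowP => j; rewrite !mxE; ring.
  apply: le_lt_trans (ler_normD _ _) _; rewrite !normrZ !ger0_norm ?subr_ge0 //.
  have [->|xn0] := eqVneq x 0; first by rewrite subr0 mul1r mul0r addr0.
  have h1 : (1 - x) * `|s - t| <= (1 - x) * e by rewrite ler_wpM2l ?subr_ge0 // ltW.
  have h2 : x * `|s - u| < x * e by rewrite ltr_pM2l // lt_neqAle eq_sym xn0.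
  lra.
(* Since I u = I s = I t, the derivative of I along u - t = k covector u vanishes at some x of the
   segment. There g and the product of the two covectors are nonzero, so k = 0 and t = u. *)
have [|x x01] := @MVT_line R _ I t u.
  by move=> x x01; apply: (smooth_differentiable sI); exact/eW/seg.
rewrite It {1}/u /orbit_chart Ipush // subrr dI; last exact/eW/seg.
rewrite uk conormalZ conormal_dot => /esym/eqP.
rewrite !mulf_eq0 (negPf (g0 _ (eW _ _))) /=; last by rewrite -uk; exact: seg.
rewrite orbC gt_eqF /=; last by apply: ecov => //; rewrite -uk; exact: seg.
move=> /eqP k0; exists (1%:M + mx_of_row z) => //; rewrite -/(orbit_chart s z) -/u.
by apply/eqP; rewrite eq_sym -subr_eq0 uk k0 scale0r.
Qed.

End OrbitChart.

(** * Regularity of the orbits with nonzero discriminant *)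

Section RegularOrbits.
Variable R : realType.
Implicit Types (s t : S4 R) (A B : 'M[R]_2).

Lemma orbit_dim4 s : disc s != 0 -> orbit_dim s = 4%N.
Proof.
move=> ds; have lf : linear (fun B => gl_act B s) by move=> c A B;
  rewrite gl_actD gl_actZ.
pose lM := GRing.isLinear.Build _ _ _ _ _ lf.
pose f : {linear 'M[R]_2 -> S4 R} := HB.pack (fun B => gl_act B s) lM.
apply/eqP; rewrite -[X in _ == X]/(2 * 2)%N -[_ == _]/(row_free (lin_mx f)) -kermx_eq0.
apply/rowV0P => v /sub_kermxP; rewrite -(vec_mxK v) mul_vec_lin => /eqP.
rewrite mxvec_eq0 => /eqP f0; rewrite (_ : vec_mx v = 0) ?raddf0 //.
by apply: (gl_act_inj ds); rewrite -[LHS]/(f (vec_mx v)) f0 -(raddf0 f).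
Qed.

Lemma smooth_push A : smooth setT (push A : S4 R -> S4 R).
Proof.
have oT := @openT (S4 R).
apply: smooth_mx => // i j; under eq_fun do rewrite mxE.
do 4![apply: smooth_sum => // ?].
by do 4![apply: smoothM => //; last exact: smooth_cst]; exact: smooth_coord.
Qed.

Lemma push_invmx A s : A \in unitmx -> push (invmx A) (push A s) = s.
Proof. by move=> uA; rewrite -pushM mulmxV // push1. Qed.

Lemma regular_GL_orbit s : disc s != 0 -> regular_orbit (GL_orbit s).
Proof.
move=> ds; split; first by exists s.
have [W [I [g [[oW Ws Wpush Wd] [sI Ipush g0 dI]]]]] := conormal_invariant ds.
have [e e0 he] := orbit_locally_level oW Ws Wd sI Ipush g0 dI.
(* The saturation of a small ball. A level set of I in all of W could contain other orbits, whereas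
   a point of U can be moved into the ball and compared with s there. *)
pose U : set (S4 R) := \bigcup_(A in [set A | A \in unitmx]) (push A @^-1` ball s e).
have oU : open U.
  apply: bigcup_open => A _; apply: open_comp => [t _|]; last exact: ball_open.
  exact: (smooth_continuous (@smooth_push A)).
have UW t : U t -> W t.
  move=> [A /= uA /he[Wt _]]; rewrite -(push_invmx t uA).
  by apply: Wpush; rewrite ?unitmx_inv.
exists 1%N, U, (fun=> I), (fun=> I s); split.
- split=> // _ [A uA ->]; exists (invmx A); first by rewrite /= unitmx_inv.
  by rewrite /= push_invmx //; exact: ballxx.
- by move=> t /(disc_orbit ds) dt; rewrite orbit_dim4.
- split=> [_ k|_ A t uA _ _]; last exact: Ipush.
  by apply: Ck_sub (sI k).
- move=> t Ut; rewrite /row_free; set v := (X in \rank X).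
  have -> : v = g t *: covector t.
    by apply/matrixP => i j; rewrite !mxE dI //; exact: UW.
  rewrite rank_rV eqb1 scaler_eq0 negb_or g0 /=; last exact: UW.
  exact: covector_neq0 (Wd t (UW t Ut)).
- apply/seteqP; split=> [_ [A uA ->]|t [[A /= uA /he[_ At]] /(_ ord0) It]].
    split; last by move=> _; rewrite Ipush.
    exists (invmx A); first by rewrite /= unitmx_inv.
    by rewrite /= push_invmx //; exact: ballxx.
  by rewrite -(GL_orbit_push s t uA); apply: At; rewrite Ipush.
Qed.

End RegularOrbits.

(** * Charts and the parallel connection *)

Lemma derive_comp (R : realType) (V W Z : normedModType R) (f : W -> Z) (h : V -> W)
    (x v : V) : differentiable h x -> differentiable f (h x) ->
  'D_v (f \o h) x = 'D_('D_v h x) f (h x).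
Proof.
move=> dh df; rewrite (deriveE _ (differentiable_comp dh df)) diff_comp //=.
by rewrite (deriveE _ df) (deriveE _ dh).
Qed.

Lemma jacobianE (R : realType) m n (f : 'rV[R]_m.+1 -> 'rV[R]_n.+1) x a b :
  differentiable f x -> 'J f x a b = ('D_(delta_mx 0 a) f x) 0 b.
Proof. by move=> df; rewrite deriveE // mxE. Qed.

Section Atlas.
Variables (R : realType) (M : topologicalType) (A : atlas R M).
Implicit Types (i j k : A) (q : M) (U : set M).

Definition transition i j : 'rV[R]_2 -> 'rV[R]_2 := coord j \o param i.

(** Identities between [coord] and [param] hold on chart images only; this supplies the
    neighbourhood on which they may be used under a derivative. *)
Lemma near_param i q U : dom i q -> open U -> U q ->
  \forall y \near coord i q,
    [/\ U (param i y), dom i (param i y) & coord i (param i y) = y].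
Proof.
move=> iq oU Uq.
have oI : nbhs (coord i q) (coord i @` dom i).
  by apply: open_nbhs_nbhs; split; [exact: image_open|exists q].
have oP : nbhs (coord i q) (param i @^-1` U).
  by apply: param_continuous => //; rewrite coordK //; exact: open_nbhs_nbhs.
near=> y; have [q' iq' yE] : (coord i @` dom i) y by near: y.
by rewrite -yE coordK //; split=> //; rewrite -(coordK iq') yE; near: y.
Unshelve. all: by end_near. Qed.

Lemma open_chart_image i U : open U -> open (coord i @` (U `&` dom i)).
Proof.
move=> oU; rewrite openE => _ [q [Uq iq] <-].
have := near_param iq oU Uq; apply: filterS => y [Uy iy yE].
by exists (param i y).
Qed.

Lemma paramK i U y : (coord i @` (U `&` dom i)) y -> coord i (param i y) = y.
Proof. by move=> [q [_ iq] <-]; rewrite coordK. Qed.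

Lemma open_dom_image i j : open (coord i @` (dom i `&` dom j)).
Proof. by rewrite setIC; apply: open_chart_image; exact: dom_open. Qed.

Lemma smooth_transition i j :
  smooth (coord i @` (dom i `&` dom j)) (transition i j).
Proof. exact: transition_smooth. Qed.

Lemma differentiable_transition i j q : dom i q -> dom j q ->
  differentiable (transition i j) (coord i q).
Proof.
move=> iq jq; apply: (smooth_differentiable (@smooth_transition i j)).
by exists q.
Qed.

Lemma transitionE i j q : dom i q -> transition i j (coord i q) = coord j q.
Proof. by move=> iq; rewrite /transition /= coordK. Qed.

Lemma derive_transition i j q v : dom i q -> dom j q ->
  'D_v (transition i j) (coord i q) = v *m jac i j q.
Proof. by move=> iq jq; rewrite deriveEjacobian //;
  exact: differentiable_transition. Qed.

Lemma jac_param i j q : dom i q -> dom j q ->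
  \forall y \near coord i q, jac i j (param i y) = 'J (transition i j) y.
Proof.
move=> iq jq; have := near_param iq (dom_open j) jq.
by apply: filterS => y [_ _ yE]; rewrite /jac yE.
Qed.

Lemma smooth_jac i j :
  smooth (coord i @` (dom i `&` dom j)) (fun y => 'J (transition i j) y).
Proof.
have oU := @open_dom_image i j; have st := @smooth_transition i j.
apply: smooth_mx => // a b.
apply: (@eq_smooth _ _ _ oU _ (fun y => ('D_(delta_mx 0 a) (transition i j) y) 0 b)).
  by move=> y Uy; rewrite jacobianE //; exact: smooth_differentiable Uy.
exact/smooth_entry/smooth_derive.
Qed.

Lemma jac_cocycle i j k q : dom i q -> dom j q -> dom k q ->
  jac i k q = jac i j q *m jac j k q.
Proof.
move=> iq jq kq; apply/row_matrixP => a.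
rewrite !rowE mulmxA; set e := delta_mx 0 a.
have dij := differentiable_transition iq jq.
have djk : differentiable (transition j k) (transition i j (coord i q)).
  by rewrite transitionE //; exact: differentiable_transition.
transitivity ('D_e (transition i k) (coord i q)); first exact/esym/derive_transition.
transitivity ('D_e (transition j k \o transition i j) (coord i q)); last first.
  rewrite (derive_comp e dij djk) (derive_transition e iq jq) (transitionE j iq).
  exact: derive_transition.
apply: near_eq_derive; have := near_param iq (dom_open j) jq.
by apply: filterS => y [jy iy yE]; rewrite /transition /= coordK.
Qed.

Lemma jac_id i q : dom i q -> jac i i q = 1%:M.
Proof.
move=> iq; apply/row_matrixP => a; rewrite !rowE mulmx1; set e := delta_mx 0 a.
transitivity ('D_e (transition i i) (coord i q)); first exact/esym/derive_transition.
rewrite -[RHS](derive_id (coord i q)); apply: near_eq_derive.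
by have := near_param iq (dom_open i) iq; apply: filterS => y [].
Qed.

Lemma jacK i j q : dom i q -> dom j q -> jac i j q *m jac j i q = 1%:M.
Proof. by move=> iq jq; rewrite -jac_cocycle // jac_id. Qed.

Lemma jac_unit i j q : dom i q -> dom j q -> jac i j q \in unitmx.
Proof.
move=> iq jq; have e := jacK iq jq.
have [u _] := @mulmx1_unit R 2 _ _ e.
exact: u.
Qed.

End Atlas.

Section SmoothSolve.
Variables (R : realType) (V : normedModType R) (U : set V).
Hypothesis oU : open U.

Lemma smooth_orbit_frame (S : V -> S4 R) : smooth U S ->
  smooth U (fun y => orbit_frame (S y)).
Proof.
move=> sS; have sE k : smooth U ((fun y => S y 0 (inord k)) : V ->
  R^o) by exact: smooth_entry.
have sH (j : 'I_5) : smooth U ((fun y => hess (S y) 0 j) : V -> R^o).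
  under eq_fun do rewrite mxE.
  case: j => [[|[|[|[|[|]]]]] //= _]; repeat first [exact: sE | exact: smooth_cst
    | apply: smoothX | apply: smoothM | apply: smoothB | apply: smoothD | done].
apply: smooth_mx => // i j; under eq_fun do rewrite mxE.
case: i => [[|[|[|[|[|]]]]] //= _]; first [exact: sH | apply: smoothM => //];
  first [exact: smooth_cst | exact: sE].
Qed.

Lemma smooth_gl_solve (S T : V -> S4 R) : (forall y, U y -> disc (S y) != 0) ->
  smooth U S -> smooth U T -> smooth U (fun y => gl_solve (S y) (T y)).
Proof.
move=> dS sS sT; apply: smooth_mx => // i j; under eq_fun do rewrite mxE.
apply: smooth_entry => //; apply: smooth_mulmx => //; apply: smooth_invmx => //.
  by move=> y /dS; exact: orbit_frame_unit.
exact: smooth_orbit_frame.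
Qed.

End SmoothSolve.

Section Dpush.
Variable R : realType.
Implicit Types (s : S4 R) (B C K : 'M[R]_2).

Lemma dpushD B K K' s : dpush B (K + K') s = dpush B K s + dpush B K' s.
Proof.
apply/rowP => m; rewrite !mxE -big_split; apply: eq_bigr => a _; rewrite -big_split.
apply: eq_bigr => b _; rewrite -big_split; apply: eq_bigr => c _; rewrite -big_split.
by apply: eq_bigr => d _ /=; rewrite !mxE; ring.
Qed.

(** With K = B C, [dpush B K s] is [gl_act C] at the point [push B s], whose discriminant is again
    nonzero. *)
Lemma dpush_inj B K K' s : B \in unitmx -> disc s != 0 ->
  dpush B K s = dpush B K' s -> K = K'.
Proof.
move=> uB ds; rewrite -(mulKVmx uB K) -(mulKVmx uB K') -!gl_act_push => e.
congr (_ *m _); apply: gl_act_inj e.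
by apply: (disc_orbit ds); exists B.
Qed.

End Dpush.

(** * Christoffel matrices determined by the symbol *)

Section Christoffel.
Variables (R : realType) (M : topologicalType) (A : atlas R M) (s : field A (S4 R)).
Hypotheses (s_symbol : symbol s) (s_regular : regular_symbol s).
Implicit Types (i j k : A) (q : M) (U : set M) (X Y : field A 'rV[R]_2).

Lemma smooth_symbol i : smooth (coord i @` dom i) (s i \o param i).
Proof. by have [+ _] := s_symbol => /(_ i); rewrite setTI. Qed.

Lemma differentiable_symbol i q : dom i q ->
  differentiable (s i \o param i) (coord i q).
Proof. by move=> iq; apply: (smooth_differentiable (@smooth_symbol i)); exists q. Qed.

Definition dsymbol i q (v : 'rV[R]_2) : S4 R := 'D_v (s i \o param i) (coord i q).

Lemma dsymbolE i q v : dom i q -> dsymbol i q v = 'd (s i \o param i) (coord i q) v.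
Proof. by move=> /differentiable_symbol ds; rewrite /dsymbol (deriveE _ ds). Qed.

Lemma dsymbolD i q v w : dom i q -> dsymbol i q (v + w) = dsymbol i q v + dsymbol i q w.
Proof. by move=> iq; rewrite !dsymbolE // raddfD. Qed.

Lemma dsymbolZ i q c v : dom i q -> dsymbol i q (c *: v) = c *: dsymbol i q v.
Proof. by move=> iq; rewrite !dsymbolE // linearZ. Qed.

(* The matrix of w |-> nabla_v w - D_v w in the chart i *)
Definition christoffel i q (v : 'rV[R]_2) : 'M[R]_2 := - gl_solve (s i q) (dsymbol i q
  v).

Lemma christoffelD i q v w : dom i q ->
  christoffel i q (v + w) = christoffel i q v + christoffel i q w.
Proof. by move=> iq; rewrite /christoffel dsymbolD // gl_solveD opprD. Qed.

Lemma christoffelZ i q c v : dom i q ->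
  christoffel i q (c *: v) = c *: christoffel i q v.
Proof. by move=> iq; rewrite /christoffel dsymbolZ // gl_solveZ scalerN. Qed.

Definition parallel_nabla X Y : field A 'rV[R]_2 := fun i q =>
  lie X (Y i) i q + Y i q *m christoffel i q (X i q).

Lemma vector_field_differentiable U Y i q : vector_field U Y -> U q -> dom i q ->
  differentiable (Y i \o param i) (coord i q).
Proof.
move=> [sY _] Uq iq; apply: (smooth_differentiable (sY i)).
by exists q.
Qed.

Lemma parallel_nabla_local U X X' Y Y' : open U -> vector_field U X ->
  vector_field U Y ->
  same_on U X X' -> same_on U Y Y' ->
  same_on U (parallel_nabla X Y) (parallel_nabla X' Y').
Proof.
move=> oU _ _ XX' YY' i q Uq iq; rewrite /parallel_nabla /lie -XX' // -YY' //.
congr (_ + _); apply: near_eq_derive.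
by have := near_param iq oU Uq; apply: filterS => y [Uy iy _]; exact: YY'.
Qed.

Lemma parallel_nabla_linear U (f : M -> R) X X' Y : open U -> smooth_fun A U f ->
  vector_field U X -> vector_field U X' -> vector_field U Y ->
  same_on U (parallel_nabla (fun i q => f q *: X i q + X' i q) Y)
    (fun i q => f q *: parallel_nabla X Y i q + parallel_nabla X' Y i q).
Proof.
move=> oU _ _ _ vY i q Uq iq; have dY := vector_field_differentiable vY Uq iq.
rewrite /parallel_nabla /lie !(deriveE _ dY) linearP christoffelD // christoffelZ //.
by rewrite mulmxDr -scalemxAr scalerDr addrACA.
Qed.

Lemma parallel_nabla_additive U X Y Y' : open U ->
  vector_field U X -> vector_field U Y -> vector_field U Y' ->
  same_on U (parallel_nabla X (fun i q => Y i q + Y' i q))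
    (fun i q => parallel_nabla X Y i q + parallel_nabla X Y' i q).
Proof.
move=> oU _ vY vY' i q Uq iq; have dY := vector_field_differentiable vY Uq iq.
have dY' := vector_field_differentiable vY' Uq iq.
rewrite /parallel_nabla /lie mulmxDl addrACA; congr (_ + _).
by apply: deriveD; exact: diff_derivable.
Qed.

Lemma parallel_nabla_leibniz U (f : M -> R) X Y : open U -> smooth_fun A U f ->
  vector_field U X -> vector_field U Y ->
  same_on U (parallel_nabla X (fun i q => f q *: Y i q))
    (fun i q => lie X (f : M -> R^o) i q *: Y i q + f q *: parallel_nabla X Y i q).
Proof.
move=> oU sf _ vY i q Uq iq; have dY := vector_field_differentiable vY Uq iq.
have df : differentiable ((f \o param i) : _ -> R^o) (coord i q).
  by apply: (smooth_differentiable (sf i)); exists q.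
rewrite /parallel_nabla scalerDr addrA -scalemxAl; congr (_ + _).
rewrite /lie; set x := coord i q in dY df *.
have dfY : differentiable (fun y => f (param i y) *: Y i (param i y)) x.
  apply: differentiable_mx => a b; under eq_fun do rewrite mxE.
  by apply: differentiableM => //; exact: differentiable_entry.
apply/rowP => b; rewrite derive_entry // !mxE.
under eq_fun do rewrite mxE.
have [_ ->] := is_derive_mul (differentiable_is_derive (X i q) df) (is_derive_mx_entry
  (X i q) 0 b dY).
by rewrite /= coordK // addrC; congr (_ + _); rewrite mulrC.
Qed.

Hypothesis tangent : forall i q v, dom i q -> conormal (s i q) (dsymbol i q v) = 0.

Lemma christoffelK i q v : dom i q ->
  gl_act (christoffel i q v) (s i q) = - dsymbol i q v.
Proof. by move=> iq; rewrite /christoffel gl_actN gl_solveK ?tangent //;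
  exact: s_regular. Qed.

(** The product rule applied to the transformation law of [s]; the [dpush] term carries the second
    derivatives of the transition map. *)
Lemma derive_symbol_transition i j q v : dom i q -> dom j q ->
  dsymbol j q (v *m jac i j q) = push (jac i j q) (dsymbol i q v)
    + dpush (jac i j q) ('D_v (fun y => 'J (transition i j) y) (coord i q)) (s i q).
Proof.
move=> iq jq; set x := coord i q; set P := jac i j q; set K := 'D_v _ x.
have dJ : differentiable (fun y => 'J (transition i j) y) x.
  by apply: (smooth_differentiable (@smooth_jac _ _ _ i j)); exists q.
have dij := differentiable_transition iq jq.
have dj : differentiable (s j \o param j) (transition i j x).
  by rewrite transitionE //; exact: differentiable_symbol.
transitivity ('D_v ((s j \o param j) \o transition i j) x).
  by rewrite (derive_comp v dij dj) (derive_transition v iq jq) transitionE.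
transitivity ('D_v (fun y => push ('J (transition i j) y) ((s i \o param i) y)) x).
  apply: near_eq_derive.
  have := jac_param iq jq; have := near_param iq (dom_open j) jq.
  apply: filterS2 => y [jy iy yE] <-; rewrite /transition /= coordK //.
  by have [_] := s_symbol; exact.
have [_ ->] := derive_push v dJ (differentiable_symbol iq).
by rewrite /= /x coordK.
Qed.

(** The classical inhomogeneous law of Christoffel symbols. Both sides have the same image under
    [dpush] with base point the Jacobian, by the derivative of the transformation law of [s], and
    that map is injective. *)
Lemma christoffel_transition i j q v : dom i q -> dom j q ->
  jac i j q *m christoffel j q (v *m jac i j q) =
  christoffel i q v *m jac i j q - 'D_v (fun y => 'J (transition i j) y) (coord i q).
Proof.
move=> iq jq; have e1 := derive_symbol_transition v iq jq; move: e1.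
set x := coord i q; set P := jac i j q; set K := 'D_v _ x => e1.
have uP : P \in unitmx by exact: jac_unit.
have ds : disc (s i q) != 0 by exact: s_regular.
have sq : s j q = push P (s i q) by have [_] := s_symbol; exact.
apply: (dpush_inj uP ds); rewrite -gl_act_push -sq christoffelK // e1.
rewrite dpushD -push_gl_act christoffelK // opprD; congr (_ + _).
  by rewrite -scaleN1r -pushZ scaleN1r.
have := dpushD P K (- K) (s i q); rewrite subrr.
have -> : dpush P 0 (s i q) = 0.
  have := dpushD P 0 0 (s i q); rewrite addr0 => /esym/eqP.
  by rewrite -subr_eq0 addrK => /eqP.
by move=> /eqP; rewrite eq_sym addrC addr_eq0 => /eqP ->.
Qed.

End Christoffel.

Section ParallelConnection.
Variables (R : realType) (M : topologicalType) (A : atlas R M) (s : field A (S4 R)).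
Hypotheses (s_symbol : symbol s) (s_regular : regular_symbol s).
Implicit Types (i j k : A) (q : M) (U : set M) (X Y : field A 'rV[R]_2).

Hypothesis tangent : forall i q v, dom i q -> conormal (s i q) (dsymbol s i q v) = 0.

Lemma smooth_parallel_nabla U X Y : open U -> smooth_field U X -> smooth_field U Y ->
  smooth_field U (parallel_nabla s X Y).
Proof.
move=> oU sX sY i; have oV := @open_chart_image _ _ _ i _ oU.
set V := coord i @` _ in oV *.
have sS : smooth V (s i \o param i).
  by move=> k; apply: Ck_sub (@smooth_symbol _ _ _ _ s_symbol i k) => _ [q [_ iq] <-];
    exists q.
pose N y := 'D_(X i (param i y)) (Y i \o param i) y
  + Y i (param i y) *m - gl_solve (s i (param i y)) ('D_(X i (param i y)) (s i \o param
    i) y).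
apply: (@eq_smooth _ _ _ oV _ N) => [y Vy|].
  by rewrite /N /parallel_nabla /lie /christoffel /dsymbol /= (paramK Vy).
have sXi := sX i; have sYi := sY i.
apply: (smooth_addmx oV); first exact: (smooth_derive_along oV).
apply: (smooth_mulmx oV) => //; apply: (smooth_mx oV) => a b.
under eq_fun do rewrite mxE.
apply: (smoothN oV); apply: (smooth_entry oV); apply: (smooth_gl_solve oV) => //.
  by move=> _ [q [_ iq] <-]; rewrite coordK //; exact: s_regular.
exact: (smooth_derive_along oV).
Qed.

(** Differentiating Y in the chart j produces a term Y K with the second derivatives of the
    transition; the inhomogeneous term of the Christoffel law cancels it. *)
Lemma parallel_nabla_transition U X Y i j q : open U -> vector_field U X ->
  vector_field U Y ->
  U q -> dom i q -> dom j q ->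
  parallel_nabla s X Y j q = parallel_nabla s X Y i q *m jac i j q.
Proof.
move=> oU [_ vX] vY Uq iq jq.
have e := christoffel_transition s_symbol s_regular tangent (X i q) iq jq; move: e.
rewrite /parallel_nabla /lie (vX i j q Uq iq jq) (vY.2 i j q Uq iq jq).
set x := coord i q; set P := jac i j q; set K := 'D_ _ _ x => e.
have dJ : differentiable (fun y => 'J (transition i j) y) x.
  by apply: (smooth_differentiable (@smooth_jac _ _ _ i j)); exists q.
have dYi := vector_field_differentiable vY Uq iq.
have dij := differentiable_transition iq jq.
have dYj : differentiable (Y j \o param j) (transition i j x).
  by rewrite transitionE //; exact: vector_field_differentiable vY Uq jq.
have -> : 'D_(X i q *m P) (Y j \o param j) (coord j q) =
    'D_(X i q) (Y i \o param i) x *m P + Y i q *m K.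
  transitivity ('D_(X i q) ((Y j \o param j) \o transition i j) x).
    by rewrite (derive_comp _ dij dYj) (derive_transition _ iq jq) transitionE.
  transitivity ('D_(X i q) (fun y => (Y i \o param i) y *m 'J (transition i j) y) x).
    apply: near_eq_derive.
    have := jac_param iq jq; have := near_param iq (dom_open j) jq.
    have := near_param iq oU Uq.
    apply: filterS3 => y [Uy _ _] [jy iy yE] <-; rewrite /transition /= coordK //.
    exact: vY.2.
  have [_ ->] := derive_mulmx (X i q) dYi dJ.
  by rewrite /= /x coordK.
rewrite -mulmxA e mulmxDl -addrA; congr (_ + _).
by rewrite mulmxBr addrC subrK mulmxA.
Qed.

Lemma parallel_nabla_field U X Y : open U -> vector_field U X -> vector_field U Y ->
  vector_field U (parallel_nabla s X Y).
Proof.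
move=> oU vX vY; split; first exact: smooth_parallel_nabla vX.1 vY.1.
by move=> i j q *; exact: parallel_nabla_transition vX vY _ _ _.
Qed.

Definition parallel_connection : connection A := @Connection _ _ _ (parallel_nabla s)
  parallel_nabla_field (@parallel_nabla_local _ _ _ s) (@parallel_nabla_linear _ _ _ _
    s_symbol)
  (@parallel_nabla_additive _ _ _ s) (@parallel_nabla_leibniz _ _ _ s).

Lemma parallel_connection_symbol X :
  same_on setT (nabla_symbol parallel_connection X s) (fun _ _ => 0).
Proof.
move=> i q _ iq; rewrite /nabla_symbol /lie -/(dsymbol s i q (X i q)).
set B := \matrix_a _; suff -> : B = christoffel s i q (X i q).
  by rewrite christoffelK // subrr.
apply/row_matrixP => a; rewrite rowK /= /parallel_nabla /lie.
(* In its own chart a coordinate field has constant components near q, so only the Christoffel term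
   of [nabla] remains. *)
have -> : 'D_(X i q) (frame i a i \o param i) (coord i q) = 0.
  rewrite -[RHS](derive_cst (row a (1%:M : 'M[R]_2)) (coord i q) (X i q)).
  apply: near_eq_derive; have := near_param iq (dom_open i) iq.
  by apply: filterS => y [iy _ _]; rewrite /= /frame jac_id.
by rewrite add0r /frame jac_id // row1 -rowE.
Qed.

End ParallelConnection.

Section ConstantType.
Variables (R : realType) (M : topologicalType) (A : atlas R M) (s : field A (S4 R)).
Hypotheses (s_symbol : symbol s) (s_regular : regular_symbol s).

(** A local invariant composed with the symbol is constant in a chart; the chain rule turns its
    derivative into [g] times the conormal, and [g] has no zero. *)
Lemma constant_type_tangent : constant_type s ->
  forall i q v, dom i q -> conormal (s i q) (dsymbol s i q v) = 0.
Proof.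
move=> [w [[s0 ->] _] sw] i q v iq.
have ds := s_regular iq.
have [W [I [g [[oW Ws _ _] [sI Ipush g0 dI]]]]] := conormal_invariant ds.
have orbit q' : dom i q' -> GL_orbit s0 (s i q').
  by move=> iq'; rewrite -[s i q']push1; apply: sw => //; exact: unitmx1.
have Ss : differentiable (s i \o param i) (coord i q) by exact: differentiable_symbol.
have dIs : differentiable I ((s i \o param i) (coord i q)).
  by rewrite /= coordK //; exact: smooth_differentiable sI Ws.
have : 'D_v (I \o (s i \o param i)) (coord i q) = 0.
  rewrite -[RHS](derive_cst (I (s i q)) (coord i q) v).
  apply: near_eq_derive; have := near_param iq (dom_open i) iq.
  apply: filterS => y [iy _ _] /=.
  have := orbit _ iy; rewrite -(eq_GL_orbit (orbit q iq)) => -[B uB ->].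
  exact: Ipush.
rewrite (derive_comp v Ss dIs) /= coordK // dI // => /eqP.
by rewrite mulf_eq0 (negPf (g0 _ Ws)) => /eqP.
Qed.

End ConstantType.

(** * Bump functions and local constancy of the orbit *)

Section Flat.
Variable R : realType.

(** The powers [t ^- n] accompany exp(-1/t) so that the span of the family is closed under
    differentiation. *)
Definition flat_exp (n : nat) (t : R) : R := if 0 < t then t ^- n * expR (- t^-1) else
  0.

(** The term of degree n + 2 in the series of exp(1/t) outweighs t^-n by a factor t^2, enough for
    the derivative at 0 to exist and vanish. *)
Lemma flat_exp_bound n t : `|flat_exp n t| <= n.+2`!%:R * t ^+ 2.
Proof.
rewrite /flat_exp; case: ifP => t0; last by rewrite normr0 mulr_ge0 ?sqr_ge0.
rewrite ger0_norm ?mulr_ge0 ?invr_ge0 ?exprn_ge0 ?expR_ge0 ?(ltW t0) //.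
rewrite expRN ler_pdivrMr ?expR_gt0 //.
have m0 : 0 < n.+2`!%:R :> R by rewrite ltr0n fact_gt0.
have hm : t^-1 ^+ n.+2 / n.+2`!%:R <= expR t^-1.
  by apply: le_trans (expR_ge1Dxn n.+1 _); rewrite ?lerDr ?ler01 // invr_ge0 ltW.
have -> : t ^- n = n.+2`!%:R * t ^+ 2 * (t^-1 ^+ n.+2 / n.+2`!%:R).
  transitivity (t^-1 ^+ n * (t * t^-1) ^+ 2 * (n.+2`!%:R / n.+2`!%:R)).
    by rewrite !divff ?gt_eqF // expr1n !mulr1 exprVn.
  by set F := n.+2`!%:R; rewrite -[n.+2]addn2 exprD; ring.
by rewrite ler_pM2l // mulr_gt0 // exprn_gt0.
Qed.

Lemma flat_exp0 n : flat_exp n 0 = 0.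
Proof. by rewrite /flat_exp ltxx. Qed.

Lemma is_derive_flat_exp n (t : R) :
  is_derive (t : R^o) 1 (flat_exp n : R^o -> R^o)
    (flat_exp n.+2 t - n%:R * flat_exp n.+1 t).
Proof.
have [t0|t0|->] := ltgtP t 0.
- have e m : flat_exp m t = 0 by rewrite /flat_exp ltNge ltW.
  rewrite !e mulr0 subr0.
  apply: (near_eq_is_derive _ (is_derive_cst (0 : R^o) (t : R^o) 1)).
  have : \forall y \near t, y < 0 by exact: lt_nbhsl.
  by apply: filterS => y y0; rewrite /flat_exp ltNge ltW.
- have tn0 : t != 0 by rewrite gt_eqF.
  have dinv : is_derive (t : R^o) 1 ((fun y => y^-1) : R^o -> R^o) (- t ^- 2).
    split; first exact: derivableV.
    by rewrite deriveV // derive_id [LHS]mulr1.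
  have dN : is_derive (t : R^o) 1 ((fun y => - y^-1) : R^o -> R^o) (t ^- 2).
    by rewrite -[t ^- 2]opprK; exact: is_deriveN.
  have dexp : is_derive (t : R^o) 1 ((fun y => expR (- y^-1)) : R^o ->
    R^o) (expR (- t^-1) * t ^- 2).
    have dfN : differentiable ((fun y => - y^-1) : R^o -> R^o) (t : R^o).
      by apply/derivable1_diffP; have [] := dN.
    exact: (is_derive_comp1 dfN dN (is_derive_expR _)).
  have dX := is_derive_mul (is_derive_exp n dinv) dexp.
  apply: (@near_eq_is_derive _ _ _ (fun y : R^o => y^-1 ^+ n * expR (- y^-1) : R^o)).
    have : \forall y \near t, 0 < y by exact: lt_nbhsr.
    by apply: filterS => y y0; rewrite /flat_exp y0 exprVn.
  apply: is_derive_eq dX _; rewrite /flat_exp t0.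
  case: n => [|n]; first by rewrite !mul0r mulr0 addr0 subr0 expr0 mul1r mulrC.
  by rewrite -!exprVn /= !exprS; ring.
rewrite !flat_exp0 mulr0 subr0.
have lim0 : (h^-1 *: ((flat_exp n \o shift 0) (h *: (1 : R^o)) - flat_exp n 0)) @[h -->
  0^'] --> (0 : R^o).
  apply/cvgrPdist_le => e e0; have C0 : 0 < n.+2`!%:R :> R by rewrite ltr0n fact_gt0.
  near=> h; rewrite /= sub0r normrN flat_exp0 subr0 addr0 [_ *: 1]mulr1 normrZ normfV.
  have h0 : h != 0 by near: h; exact: nbhs_dnbhs_neq.
  rewrite ler_pdivrMl ?normr_gt0 //; apply: le_trans (flat_exp_bound n h) _.
  rewrite -[h ^+ 2]real_normK ?num_real // expr2 mulrCA ler_wpM2l // -ler_pdivlMl //.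
  near: h; apply: dnbhs0_le; by rewrite mulr_gt0 ?invr_gt0.
split; first by apply/cvg_ex; exists 0.
exact: cvg_lim lim0.
Unshelve. all: by end_near. Qed.

Inductive flat_span : (R -> R) -> Prop :=
| Flat_exp n : flat_span (flat_exp n)
| Flat_add c f g : flat_span f -> flat_span g -> flat_span (fun t => f t + c * g t).

Lemma smooth_flat_exp (V : normedModType R) (U : set V) (f : V -> R^o) :
  open U -> smooth U f -> smooth U ((fun x => flat_exp 0 (f x)) : V -> R^o).
Proof.
move=> oU sf k; apply: (@Ck_comp1 R V setT flat_span k U f) => //.
  move=> p; elim=> [n|c g h _ [g' sg' dg] _ [h' sh' dh]].
    exists (fun t => flat_exp n.+2 t + - n%:R * flat_exp n.+1 t).
      by apply: Flat_add; exact: Flat_exp.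
    by move=> t _; apply: is_derive_eq (is_derive_flat_exp n t) _; rewrite mulNr.
  exists (fun t => g' t + c * h' t); first exact: Flat_add.
  move=> t _; apply: is_derive_eq.
    apply: is_derive_add; first exact: dg.
    by apply: is_derive_mul; exact: dh.
  by rewrite mulr0 addr0.
exact: Flat_exp.
Qed.

End Flat.

Lemma compact_closed_ball_row (R : realType) n (x : 'rV[R]_n.+1) (r : R) :
  0 < r -> compact [set y : 'rV[R]_n.+1 | `|x - y| <= r].
Proof.
move=> r0; apply: bounded_closed_compact.
  exists (`|x| + r); split=> [|N xrN y /= yr]; first exact: num_real.
  by rewrite -(subKr x y) (le_trans (ler_normB _ _)) // (le_trans _ (ltW xrN)) //
    lerD2l.
by have := @closed_ball_closed R _ x r; rewrite (closed_ballE _ r0).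
Qed.

(** * Global vector fields with a prescribed value at a point *)

Section Bump.
Variables (R : realType) (M : topologicalType) (A : atlas R M).
Hypothesis M_hausdorff : hausdorff_space M.
Implicit Types (i j k : A) (q : M) (U : set M) (v : 'rV[R]_2).

(** Supported in a Euclidean ball, because the sum of squares is smooth; that ball lies inside the
    ball of radius r for the maximum norm. *)
Definition bump_at (x0 : 'rV[R]_2) (r : R) (x : 'rV[R]_2) : R :=
  flat_exp 0 (r ^+ 2 - \sum_a (x 0 a - x0 0 a) ^+ 2).

Lemma bump_center x0 r : 0 < r -> bump_at x0 r x0 != 0.
Proof.
move=> r0; rewrite /bump_at big1 => [|a _]; last by rewrite subrr expr0n.
by rewrite subr0 /flat_exp exprn_gt0 // expr0 invr1 mul1r gt_eqF // expR_gt0.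
Qed.

Lemma bump_out x0 r x : 0 < r -> r < `|x0 - x| -> bump_at x0 r x = 0.
Proof.
rewrite distrC => r0 rx; rewrite /bump_at /flat_exp ifF //; apply/negbTE;
  rewrite -leNgt subr_le0.
have [[a b] /= xab] : exists ab, mx_norm (x - x0) = `|(x - x0) ab.1 ab.2|.
  by apply: mx_norm_neq0; rewrite -[mx_norm _]/`|x - x0| gt_eqF // (lt_trans r0).
rewrite (bigD1 b) //= -[X in X <= _]addr0 lerD ?sumr_ge0 // => [|c _];
  last exact: sqr_ge0.
rewrite -[X in _ <= X]real_normK ?num_real //; apply: lerXn2r;
  rewrite ?nnegrE ?(ltW r0) //.
by apply: le_trans (ltW rx) _; rewrite [`|x - x0|]xab ord1 !mxE.
Qed.

Lemma smooth_bump (U : set 'rV[R]_2) x0 r (h : 'rV[R]_2 -> 'rV[R]_2) : open U ->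
  smooth U h ->
  smooth U ((fun x => bump_at x0 r (h x)) : _ -> R^o).
Proof.
move=> oU sh; apply: (smooth_flat_exp oU).
apply: (smoothB oU); first exact: smooth_cst.
apply: (smooth_sum oU) => a; apply: (smoothX oU); apply: (smoothB oU);
  last exact: smooth_cst.
exact: smooth_entry.
Qed.

Definition bump_field i (x0 : 'rV[R]_2) (r c : R) v : field A 'rV[R]_2 := fun j q =>
  if `[< dom i q >] then (c * bump_at x0 r (coord i q)) *: (v *m jac i j q) else 0.

Lemma smooth_bump_field i x0 r c v : 0 < r ->
  [set y | `|x0 - y| <= r] `<=` coord i @` dom i ->
  vector_field setT (bump_field i x0 r c v).
Proof.
move=> r0 Ki; split=> [j k|j k q _ jq kq]; last first.
  rewrite /bump_field; case: asboolP => iq; last by rewrite mul0mx.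
  by rewrite -scalemxAl -mulmxA -jac_cocycle.
apply: Ck_local => _ [q [_ jq] <-]; have [iq|niq] := pselect (dom i q).
  exists (coord j @` (dom j `&` dom i)); first by exists q.
  have oV := @open_dom_image _ _ _ j i; set V := _ @` _ in oV *.
  (* [jac i j] is a Jacobian taken at the coordinates of i. To see it as a smooth function of the
     coordinates of j, it is rewritten as the inverse Jacobian of the opposite transition. *)
  pose F y : 'rV[R]_2 := (c * bump_at x0 r (transition j i y)) *:
    (v *m invmx ('J (transition j i) y)).
  have sF : smooth V F.
    apply: (smooth_scalemx oV).
      apply: (smoothM oV); first exact: smooth_cst.
      by apply: (smooth_bump _ _ oV); exact: smooth_transition.
    apply: (smooth_mulmx oV); first exact: smooth_cst.
    apply: (smooth_invmx oV); last exact: smooth_jac.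
    by move=> _ [q' [jq' iq'] <-]; exact: jac_unit.
  apply: eq_Ck (sF k) => // _ [q' [jq' iq'] <-].
  rewrite /F /bump_field /= coordK // asboolT // transitionE //; congr (_ *: (_ *m _)).
  rewrite -[X in invmx X]/(jac j i q') -[LHS]mul1mx -(jacK iq' jq') mulmxK //.
  exact: jac_unit.
(* K is compact, hence closed since M is Hausdorff; off the domain of i, its complement is an open
   neighbourhood on which the field is zero. *)
pose K := param i @` [set y | `|x0 - y| <= r].
have cK : closed K.
  apply: compact_closed => //; apply: continuous_compact;
    last exact: compact_closed_ball_row.
  apply: continuous_in_subspaceT => y; rewrite inE => /Ki[q' iq' <-].
  exact: param_continuous.
have Kdom q' : K q' -> dom i q' by move=> [y /Ki[p ip <-] <-]; rewrite coordK.
exists (coord j @` (~` K `&` dom j)); first by exists q => //; split=> // /Kdom.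
apply: (@eq_Ck _ _ _ _ _ (fun=> 0)); last exact: Ck_cst.
  by apply: open_chart_image; exact: closed_openC.
move=> _ [q' [nK jq'] <-]; rewrite /bump_field /= coordK //.
case: asboolP => // iq'; rewrite bump_out ?mulr0 ?scale0r // ltNge.
by apply/negP => h; apply: nK; exists (coord i q') => //; rewrite coordK.
Qed.

(** The equation for the connection is assumed for fields on all of M; this turns it into a
    condition on each tangent vector. The constant in the witness normalises the bump to 1 at its
    centre. *)
Lemma vector_field_through i q v : dom i q ->
  exists2 X : field A 'rV[R]_2, vector_field setT X & X i q = v.
Proof.
move=> iq; set x0 := coord i q.
have /nbhs_ballP[e /= e0 he] : nbhs x0 (coord i @` dom i).
  by apply: open_nbhs_nbhs; split; [exact: image_open|exists q].
have r0 : 0 < e / 2 by rewrite divr_gt0.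
exists (bump_field i x0 (e / 2) (bump_at x0 (e / 2) x0)^-1 v).
  apply: smooth_bump_field => // y /= ye; apply: he; rewrite -ball_normE /=.
  by apply: le_lt_trans ye _; rewrite ltr_pdivrMr // ltr_pMr // ltr1n.
by rewrite /bump_field asboolT // -/x0 mulVf ?bump_center // scale1r jac_id // mulmx1.
Qed.

End Bump.

(** * From tangency to constancy of the orbit *)

Section LocallyConstant.
Variables (R : realType) (M : topologicalType) (A : atlas R M) (s : field A (S4 R)).
Hypotheses (s_symbol : symbol s) (s_regular : regular_symbol s).
Hypothesis tangent : forall i q v, dom i q -> conormal (s i q) (dsymbol s i q v) = 0.

Lemma symbol_orbit_chart (i j : A) q : dom i q -> dom j q ->
  GL_orbit (s i q) = GL_orbit (s j q).
Proof.
move=> iq jq; apply: eq_GL_orbit; exists (jac j i q); first exact: jac_unit.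
by have [_] := s_symbol; exact.
Qed.

Lemma orbit_locally_constant (i : A) q : dom i q ->
  \forall q' \near q, dom i q' /\ GL_orbit (s i q) (s i q').
Proof.
move=> iq; have ds := s_regular iq; pose S := s i \o param i.
have [W [I [g [[oW Ws _ Wd] [sI Ipush g0 dI]]]]] := conormal_invariant ds.
have [e e0 he] := orbit_locally_level oW Ws Wd sI Ipush g0 dI.
have Sx : S (coord i q) = s i q by rewrite /S /= coordK.
have oD : open (coord i @` dom i) by exact: image_open.
have : \forall y \near coord i q, (coord i @` dom i) y /\ ball (s i q) e (S y).
  apply: filterI; first by apply: open_nbhs_nbhs; split=> //; exists q.
  have cS : {for coord i q, continuous S}.
    by apply: (smooth_continuous (@smooth_symbol _ _ _ _ s_symbol i)); exists q.
  by apply: cS; rewrite Sx; exact: nbhsx_ballx.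
move=> /nbhs_ballP[r /= r0 hr].
have level y : ball (coord i q) r y -> GL_orbit (s i q) (S y).
  move=> xy; have [_ /he[_]] := hr y xy; apply; rewrite -Sx.
  pose x := coord i q; have seg t : 0 <= t <= 1 -> ball x r (x + t *: (y - x)).
    move=> /andP[t0 t1]; move: xy; rewrite -!ball_normE /= -/x => xy.
    rewrite opprD addNKr normrN normrZ ger0_norm // distrC.
    by apply: le_lt_trans xy; rewrite ler_piMl.
  have dIS t : 0 <= t <= 1 -> let z := x + t *: (y - x) in
      [/\ differentiable S z, differentiable I (S z), W (S z) &
          exists2 q', dom i q' & coord i q' = z].
    move=> t01 z; have [[q' iq' zE] /he[Wz _]] := hr z (seg t t01).
    split; [|exact: smooth_differentiable sI Wz|exact: Wz|by exists q'].
    apply: (smooth_differentiable (@smooth_symbol _ _ _ _ s_symbol i)).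
    by exists q'.
  (* By the chain rule and tangency the derivative of I along the symbol is 0 on the whole segment,
     so s at both ends has the same invariant, and closeness makes the orbits equal. *)
  have [|t t01] := @MVT_line R _ (I \o S) x y.
    by move=> t /dIS[dS dI' _ _]; exact: differentiable_comp.
  have [dS dI' Wz [q' iq' zE]] := dIS t t01.
  rewrite (derive_comp _ dS dI') dI // -zE -[X in conormal X _]/(s i (param i (coord i
    q'))).
  rewrite coordK // tangent // mulr0 => /eqP.
  by rewrite subr_eq0 => /eqP.
have near_dom : nbhs q (dom i) by apply: open_nbhs_nbhs; split=> //; exact: dom_open.
have near_ball : nbhs q (coord i @^-1` ball (coord i q) r).
  by apply: Defs.coord_continuous => //; exact: nbhsx_ballx.
apply: filterS2 near_dom near_ball => q' iq' /level.
by rewrite /S /= coordK.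
Qed.

Lemma orbit_constant (i : A) q : connected [set: M] -> dom i q ->
  forall j q', dom j q' -> GL_orbit (s i q) (s j q').
Proof.
move=> M_connected iq.
pose B := [set p : M | forall j, dom j p -> GL_orbit (s i q) (s j p)].
have BP j p : dom j p -> GL_orbit (s i q) (s j p) -> B p.
  move=> jp orb k kp; rewrite -(eq_GL_orbit orb) (symbol_orbit_chart jp kp).
  exact: GL_orbit_refl.
suff BT : B = setT.
  by move=> j q' jq'; have : setT q' by []; rewrite -BT; exact.
apply: M_connected.
- by exists q; exact: BP iq (GL_orbit_refl _).
- exists B; rewrite ?setTI // openE => p Bp; have [j jp] := dom_cover A p.
  have := orbit_locally_constant jp; apply: filterS => p' [jp' orb].
  by apply: (BP j) => //; rewrite -(eq_GL_orbit (Bp j jp)).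
(* Closedness: the symbol keeps its orbit near p, so a point of B close to p would put p in B. *)
- exists B; rewrite ?setTI //; rewrite -openC openE => p nBp;
  have [j jp] := dom_cover A p.
  have := orbit_locally_constant jp; apply: filterS => p' [jp' orb] Bp'.
  by apply: nBp; apply: (BP j) => //;
    rewrite -(eq_GL_orbit (Bp' j jp')) (eq_GL_orbit orb); exact: GL_orbit_refl.
Qed.

End LocallyConstant.

Theorem theorem4 (R : realType) (M : topologicalType) (A : atlas R M)
    (M_hausdorff : hausdorff_space M) (M_countable : @second_countable M)
    (M_connected : connected [set: M]) (M_oriented : oriented A)
    (s : field A (S4 R)) (s_symbol : symbol s) (s_regular : regular_symbol s) :
  constant_type s <->
  exists D : connection A, forall X : field A 'rV[R]_2,
    vector_field setT X -> same_on setT (nabla_symbol D X s) (fun _ _ => 0).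
Proof.
split=> [s_const|[D Ds]].
  have tangent := constant_type_tangent s_symbol s_regular s_const.
  exists (parallel_connection s_symbol s_regular tangent) => X _.
  exact: parallel_connection_symbol.
(* Whatever the connection, the equation writes the derivative of [s] as minus a [gl_act], which the
   conormal kills. *)
have tangent (i : A) q v : dom i q -> conormal (s i q) (dsymbol s i q v) = 0.
  move=> iq; have [X vX Xv] := vector_field_through M_hausdorff v iq.
  have := Ds X vX i q Logic.I iq; rewrite /nabla_symbol /lie Xv -/(dsymbol s i q v).
  by move=> /eqP; rewrite addr_eq0 -gl_actN => /eqP ->; exact: conormal_gl_act.
have [[q _]|M0] := pselect ([set: M] !=set0).
  have [i iq] := dom_cover A q.
  exists (GL_orbit (s i q)); first by apply: regular_GL_orbit; exact: s_regular.
  move=> j p jp B uB; apply/GL_orbit_push => //.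
  exact: (orbit_constant s_symbol s_regular tangent M_connected iq).
(* On the empty manifold any regular orbit will do; this is x^4 + y^4, with i2 = 1 and i3 = 0. *)
pose s0 : S4 R := \row_(m < 5) (m \in [:: ord0; ord_max])%:R.
exists (GL_orbit s0); last by move=> i q; case: M0; exists q.
apply: regular_GL_orbit; rewrite discE /i2 /i3 /s0 !mxE !inE -!val_eqE /= !inordK //=.
by apply/eqP; lra.
Qed.
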